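(* There exist an integer $q\ge 1$ and a tower of finite connected $(q+1)$-regular Ramanujan graphs $\cdots \to X_{n+1}\to X_n\to\cdots\to X_1$ (indexed by $n\in\mathbb{N}$, $n\geq 1$, with compatible universal covering maps of the $X_n$ as described in the context) such that: (1) there is a common bound on the girth of all the graphs, i.e. there is a constant $M$ with $\operatorname{girth}(X_n)\le M$ for all $n$; (2) the minimal common covering of all the graphs $X_n$ is the universal covering tree.
   Context: A graph $X$ consists of a set of vertices $VX$, a set of directed edges $EX$, a fixed-point-free involution $e\mapsto\overline{e}$ on $EX$, and maps $o,t:EX\to VX$ (origin and terminus) with $o\overline e=te$ and $t\overline e=oe$. A geometric edge is a pair $\{e,\overline e\}$. Loops and multiple edges are allowed; all graphs are connected. The link of a vertex $v$ is $\{e\in EX: oe=v\}$. A graph is $(q+1)$-regular if every link has $q+1$ elements. The adjacency operator of $X$ acts on functions on $VX$ by $(Af)(v)=\sum_{e\in EX,\,oe=v} f(te)$. A finite $(q+1)$-regular graph is called Ramanujan if $|\lambda|\le 2\sqrt q$ for every eigenvalue $\lambda\neq\pm(q+1)$ of its adjacency operator. The girth of a graph is the length of a shortest circuit; a loop is a circuit of length $1$, and a pair of distinct geometric edges with the same two distinct endpoints is a circuit of length $2$. A covering map of graphs is a surjective graph morphism that induces a bijection from the link of $v$ to the link of its image, for every vertex $v$. A tower of graphs is an infinite sequence of graphs with covering maps $f_n:X_{n+1}\to X_n$. Minimal common covering: let $T$ be the common universal covering tree of the graphs in the tower (here the $(q+1)$-regular tree), with universal covering maps $p_n:T\to X_n$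 chosen compatibly, i.e. $p_n=f_n\circ p_{n+1}$ for all $n$. Let $H_n\le\operatorname{Aut}(T)$ be the deck transformation group of $p_n$ (the fundamental group of $X_n$), so that $X_n\cong H_n\backslash T$ and $H_{n+1}\le H_n$. The minimal common covering of the $X_n$ is the graph $\left(\bigcap_n H_n\right)\backslash T$. It is the universal covering tree exactly when $\bigcap_n H_n$ is trivial. The compatible covering maps $p_n$ are part of the data. *)

(* Defs.v *)
From HB Require Import structures.
From mathcomp Require Import all_boot all_order all_algebra.
From mathcomp Require Import boolp classical_sets functions cardinality fsbigop.
From mathcomp Require Import reals.
From mathcomp.real_closed Require Import complex.

Set Implicit Arguments.
Unset Strict Implicit.
Unset Printing Implicit Defensive.

Import Order.TTheory GRing.Theory Num.Theory.

Local Open Scope classical_set_scope.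
Local Open Scope ring_scope.
Local Open Scope quotient_scope.

(* Graphs in the sense of Serre.  The carriers are choiceTypes, so that finite
   graphs, infinite trees and quotient graphs all live in the same type. *)
Record graph := Graph {
  vertex : choiceType;
  edge : choiceType;
  orig : edge -> vertex;
  einv : edge -> edge;
  einvK : involutive einv;
  einv_neq : forall e, einv e <> e }.

Definition term (X : graph) (e : edge X) : vertex X := orig (einv e).

Definition link (X : graph) (v : vertex X) : set (edge X) :=
  [set e | orig e = v].

Definition finite_graph (X : graph) : Prop :=
  finite_set [set: vertex X] /\ finite_set [set: edge X].

Definition regular (k : nat) (X : graph) : Prop :=
  forall v : vertex X, (link v #= `I_k)%card.

Definition adjacent (X : graph) (u v : vertex X) : bool :=
  `[< exists2 e : edge X, orig e = u & term e = v >].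

Definition connected_graph (X : graph) : Prop :=
  (exists v : vertex X, True) /\
  forall u v : vertex X,
    exists2 s : seq (vertex X), path (@adjacent X) u s & last u s = v.

(* A closed walk, given by its edges, through pairwise distinct vertices and
   pairwise distinct geometric edges.  The last clause only matters in length 2,
   where it excludes the backtracking walk e, einv e. *)
Definition circuit (X : graph) (c : seq (edge X)) : bool :=
  [&& c != [::],
      cycle (fun e e' => term e == orig e') c,
      uniq [seq orig e | e <- c] &
      all (fun e => einv e \notin c) c].

Definition has_girth (X : graph) (g : nat) : Prop :=
  (exists2 c : seq (edge X), circuit c & size c = g) /\
  (forall c : seq (edge X), circuit c -> (g <= size c)%N).

Definition tree (X : graph) : Prop :=
  connected_graph X /\ forall c : seq (edge X), ~~ circuit c.

Section Ramanujan.
Variables (R : realType) (X : graph).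

Definition adjacency (f : vertex X -> R[i]) (v : vertex X) : R[i] :=
  \sum_(e \in link v) f (term e).

Definition adjacency_eigenvalue (a : R[i]) : Prop :=
  exists2 f : vertex X -> R[i],
    (exists v, f v != 0) & forall v, adjacency f v = a * f v.

Definition ramanujan (q : nat) : Prop :=
  [/\ finite_graph X, regular q.+1 X &
      forall a : R[i], adjacency_eigenvalue a ->
        a != q.+1%:R -> a != - q.+1%:R -> `|a| <= 2 * sqrtC q%:R].

End Ramanujan.

(* The vertex map is not determined by the edge map at isolated vertices. *)
Record graph_hom (X Y : graph) := Hom {
  vmap : vertex X -> vertex Y;
  emap : edge X -> edge Y;
  hom_orig : forall e, vmap (orig e) = orig (emap e);
  hom_einv : forall e, emap (einv e) = einv (emap e) }.

Definition hom_eq (X Y : graph) (f g : graph_hom X Y) : Prop :=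
  vmap f =1 vmap g /\ emap f =1 emap g.

Definition hom_id (X : graph) : graph_hom X X :=
  @Hom X X id id (fun=> erefl) (fun=> erefl).

Lemma hom_comp_orig (X Y Z : graph) (g : graph_hom Y Z) (f : graph_hom X Y) e :
  (vmap g \o vmap f) (orig e) = orig ((emap g \o emap f) e).
Proof. by rewrite /= !hom_orig. Qed.

Lemma hom_comp_einv (X Y Z : graph) (g : graph_hom Y Z) (f : graph_hom X Y) e :
  (emap g \o emap f) (einv e) = einv ((emap g \o emap f) e).
Proof. by rewrite /= !hom_einv. Qed.

Definition hom_comp (X Y Z : graph) (g : graph_hom Y Z) (f : graph_hom X Y) :
  graph_hom X Z :=
  Hom (hom_comp_orig g f) (hom_comp_einv g f).

Definition hom_inverse (X Y : graph) (f : graph_hom X Y) (g : graph_hom Y X) : Prop :=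
  hom_eq (hom_comp g f) (hom_id X) /\ hom_eq (hom_comp f g) (hom_id Y).

Definition isomorphism (X Y : graph) (f : graph_hom X Y) : Prop :=
  exists g : graph_hom Y X, hom_inverse f g.

Definition covering (X Y : graph) (f : graph_hom X Y) : Prop :=
  [/\ set_surj [set: vertex X] [set: vertex Y] (vmap f),
      set_surj [set: edge X] [set: edge Y] (emap f) &
      forall v : vertex X, set_bij (link v) (link (vmap f v)) (emap f)].

Definition universal_covering (T X : graph) (p : graph_hom T X) : Prop :=
  tree T /\ covering p.

Record aut_group (T : graph) := AutGroup {
  aut_set : set (graph_hom T T);
  aut_setP : forall h, aut_set h -> isomorphism h;
  aut_set1 : aut_set (hom_id T);
  aut_setM : forall g h, aut_set g -> aut_set h -> aut_set (hom_comp g h);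
  aut_setV : forall g h, aut_set g -> hom_inverse g h -> aut_set h }.

Definition without_inversion (T : graph) (H : aut_group T) : Prop :=
  forall h e, aut_set H h -> emap h e <> einv e.

Section Quotient.
Variables (T : graph) (H : aut_group T).

Definition vorbit_rel (u v : vertex T) : bool :=
  `[< exists2 h, aut_set H h & vmap h u = v >].

Definition eorbit_rel (d e : edge T) : bool :=
  `[< exists2 h, aut_set H h & emap h d = e >].

Lemma vorbit_equiv : equiv_class_of vorbit_rel.
Proof.
split=> [u|u v|v u w].
- by apply/asboolP; exists (hom_id T) => //; exact: aut_set1.
- suff sub a b : vorbit_rel a b -> vorbit_rel b a by apply/idP/idP; exact: sub.
  move=> /asboolP[h Hh <-]; have [k hk] := aut_setP Hh.
  by apply/asboolP; exists k; [exact: aut_setV hk|exact: hk.1.1].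
- move=> /asboolP[h Hh <-] /asboolP[k Hk <-].
  by apply/asboolP; exists (hom_comp k h) => //; exact: aut_setM.
Qed.

Lemma eorbit_equiv : equiv_class_of eorbit_rel.
Proof.
split=> [u|u v|v u w].
- by apply/asboolP; exists (hom_id T) => //; exact: aut_set1.
- suff sub a b : eorbit_rel a b -> eorbit_rel b a by apply/idP/idP; exact: sub.
  move=> /asboolP[h Hh <-]; have [k hk] := aut_setP Hh.
  by apply/asboolP; exists k; [exact: aut_setV hk|exact: hk.1.2].
- move=> /asboolP[h Hh <-] /asboolP[k Hk <-].
  by apply/asboolP; exists (hom_comp k h) => //; exact: aut_setM.
Qed.

Canonical vorbit_equiv_rel := EquivRelPack vorbit_equiv.
Canonical eorbit_equiv_rel := EquivRelPack eorbit_equiv.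

Definition vorbit : choiceType := {eq_quot vorbit_equiv_rel}.
Definition eorbit : choiceType := {eq_quot eorbit_equiv_rel}.

Definition vorbit_of (v : vertex T) : vorbit := \pi_{eq_quot vorbit_equiv_rel} v.
Definition eorbit_of (e : edge T) : eorbit := \pi_{eq_quot eorbit_equiv_rel} e.

Lemma vorbitP u v : vorbit_of u = vorbit_of v <-> exists2 h, aut_set H h & vmap h u = v.
Proof.
by split=> [/eqmodP/asboolP//|uv]; apply/eqmodP/asboolP.
Qed.

Lemma eorbitP d e : eorbit_of d = eorbit_of e <-> exists2 h, aut_set H h & emap h d = e.
Proof.
by split=> [/eqmodP/asboolP//|de]; apply/eqmodP/asboolP.
Qed.

Definition erepr (d : eorbit) : edge T :=
  @repr _ {eq_quot eorbit_equiv_rel} d.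

Lemma ereprK d : eorbit_of (erepr d) = d.
Proof. exact: (@reprK _ {eq_quot eorbit_equiv_rel}). Qed.

Definition qorig (d : eorbit) : vorbit := vorbit_of (orig (erepr d)).
Definition qeinv (d : eorbit) : eorbit := eorbit_of (einv (erepr d)).

Lemma qorigE e : vorbit_of (orig e) = qorig (eorbit_of e).
Proof.
have /eorbitP[h Hh he] := ereprK (eorbit_of e).
by apply/esym/vorbitP; exists h => //; rewrite hom_orig he.
Qed.

Lemma qeinvE e : eorbit_of (einv e) = qeinv (eorbit_of e).
Proof.
have /eorbitP[h Hh he] := ereprK (eorbit_of e).
by apply/esym/eorbitP; exists h => //; rewrite hom_einv he.
Qed.

Lemma qeinvK : involutive qeinv.
Proof. by move=> d; rewrite -(ereprK d) -!qeinvE einvK. Qed.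

Hypothesis niH : without_inversion H.

Lemma qeinv_neq d : qeinv d <> d.
Proof.
rewrite -{2}(ereprK d) => /esym/eorbitP[h Hh].
exact: niH.
Qed.

Definition quotient_graph : graph :=
  @Graph vorbit eorbit qorig qeinv qeinvK qeinv_neq.

Definition quotient_map : graph_hom T quotient_graph :=
  @Hom T quotient_graph vorbit_of eorbit_of qorigE qeinvE.

End Quotient.

Section Deck.
Variables (T X : graph) (p : graph_hom T X).

Definition deck_set : set (graph_hom T T) :=
  [set h | isomorphism h /\ hom_eq (hom_comp p h) p].

Lemma deck_setP h : deck_set h -> isomorphism h.
Proof. by case. Qed.

Lemma deck_set1 : deck_set (hom_id T).
Proof. by split; [exists (hom_id T)|]. Qed.

Lemma deck_setM g h : deck_set g -> deck_set h -> deck_set (hom_comp g h).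
Proof.
move=> [[g' [[gv ge] [g'v g'e]]] [pgv pge]] [[h' [[hv he] [h'v h'e]]] [phv phe]].
rewrite /= in gv ge g'v g'e pgv pge hv he h'v h'e phv phe.
split; last first.
  by split=> x /=; [rewrite -[RHS]phv -[RHS]pgv|rewrite -[RHS]phe -[RHS]pge].
exists (hom_comp h' g'); split; split=> x /=.
- by rewrite [X in vmap h' X]gv; exact: hv.
- by rewrite [X in emap h' X]ge; exact: he.
- by rewrite [X in vmap g X]h'v; exact: g'v.
- by rewrite [X in emap g X]h'e; exact: g'e.
Qed.

Lemma deck_setV g h : deck_set g -> hom_inverse g h -> deck_set h.
Proof.
move=> [_ [pgv pge]] [gh hg]; split; first by exists g.
split=> x /=.
- by rewrite -[LHS]pgv /=; congr (vmap p _); exact: hg.1.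
- by rewrite -[LHS]pge /=; congr (emap p _); exact: hg.2.
Qed.

Definition deck : aut_group T :=
  AutGroup deck_setP deck_set1 deck_setM deck_setV.

End Deck.

Section MinimalCommonCovering.
Variables (T : graph) (X : nat -> graph) (p : forall n, graph_hom T (X n)).

Definition common_deck_set : set (graph_hom T T) :=
  \bigcap_n aut_set (deck (p n)).

Lemma common_deck_setP h : common_deck_set h -> isomorphism h.
Proof. by move=> /(_ 0%N I); exact: deck_setP. Qed.

Lemma common_deck_set1 : common_deck_set (hom_id T).
Proof. by move=> n _; exact: deck_set1. Qed.

Lemma common_deck_setM g h :
  common_deck_set g -> common_deck_set h -> common_deck_set (hom_comp g h).
Proof. by move=> Hg Hh n _; apply: deck_setM; [exact: Hg|exact: Hh]. Qed.

Lemma common_deck_setV g h :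
  common_deck_set g -> hom_inverse g h -> common_deck_set h.
Proof. by move=> Hg gh n _; apply: deck_setV gh; exact: Hg. Qed.

Definition common_deck : aut_group T :=
  AutGroup common_deck_setP common_deck_set1 common_deck_setM common_deck_setV.

Lemma common_deck_without_inversion : without_inversion common_deck.
Proof.
move=> h e /(_ 0%N I)[_ [_ pe]] he; have := pe e.
by rewrite /= he hom_einv; exact: einv_neq.
Qed.

Definition minimal_common_covering : graph :=
  quotient_graph common_deck_without_inversion.

Definition minimal_common_covering_map : graph_hom T minimal_common_covering :=
  quotient_map common_deck_without_inversion.

End MinimalCommonCovering.

(* Main.v *)
(* Take q = 4 and let X_0 be the graph with two vertices and five parallel edges; every
   X_{n+1} is a 2-lift of X_n, given by a signing s of its edges.  Two properties of s are
   prescribed: the two edges of some digon get the same sign, so the digon lifts and the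
   girth stays 2, and some given cycle D gets sign -1, so it is opened.  The new
   eigenvalues are those of the signed adjacency matrix A_s, and as in the theorem of
   Marcus, Spielman and Srivastava a good s is found by averaging det (x - A_s).

   - x - A_s is a constant minus a sum of independent rank one matrices, so all partial
     averages are stable and interlace; if the average is positive on [4, +oo[, then so is
     some det (x - A_s).
   - If the two digon edges are merged into one edge of weight 2, the average over all s
     is a weighted matching polynomial, which is positive for x >= 4 by the Heilmann-Lieb
     recursion.  Conditioning on the sign -1 of D adds twice the matching polynomial of
     the graph without D, and so only helps.

   The universal cover is the tree of reduced words in five involutions.  A reduced word
   closed at the base point of X_n runs through a cycle; opening it makes the lifted walk
   visit more vertices, which can happen only finitely often.  Treating every word
   infinitely often makes the intersection of the deck groups trivial. *)
From mathcomp Require Import all_boot all_order all_algebra all_fingroup.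
From mathcomp Require Import boolp reals lra ring.
From mathcomp.real_closed Require Import complex polyrcf.
Require Import Defs.

Set Implicit Arguments.
Unset Strict Implicit.
Unset Printing Implicit Defensive.

Import Order.TTheory GRing.Theory Num.Theory.

Local Open Scope ring_scope.

(** * Interlacing of real polynomials *)

Section RealPolynomials.
Variable R : rcfType.
Implicit Types f g h p q : {poly R}.

(** The Wronskian condition says that [g / f] has derivative at most 0. To stay within polynomials,
    suppose that the ratio increases and take a line [l] of positive slope with both ends strictly
    inside the gap. Then [k = g - l * f] goes from negative to positive, yet its derivative is
    negative at each root in between. *)
Lemma ratio_nonincreasing f g (a b : R) : a <= b ->
    (forall x, a <= x <= b -> 0 < f.[x]) ->
    (forall x, 0 <= f^`().[x] * g.[x] - f.[x] * g^`().[x]) ->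
  g.[b] * f.[a] <= g.[a] * f.[b].
Proof.
rewrite le_eqVlt => /predU1P[->//|ab] f_gt0 W_ge0.
have fa : 0 < f.[a] by apply: f_gt0; rewrite lexx ltW.
have fb : 0 < f.[b] by apply: f_gt0; rewrite lexx ltW.
rewrite leNgt; apply/negP => lt_gf.
(* A third of the gap: moving both ends of the line inwards by [e] still leaves a rise of [e]. *)
pose e := (g.[b] / f.[b] - g.[a] / f.[a]) / 3.
have e_gt0 : 0 < e.
  by rewrite divr_gt0// subr_gt0 ltr_pdivrMr// mulrAC ltr_pdivlMr.
have ba : 0 < b - a by rewrite subr_gt0.
pose l := (g.[a] / f.[a] + e)%:P + (e / (b - a)) *: ('X - a%:P).
have la : l.[a] = g.[a] / f.[a] + e by rewrite !hornerE subrr mulr0 addr0.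
have lb : l.[b] = g.[b] / f.[b] - e.
  by rewrite !hornerE divfK ?gt_eqF// /e; lra.
have l' x : l^`().[x] = e / (b - a) by rewrite !derivE !hornerE.
pose k := g - l * f.
have kE x : k.[x] = g.[x] - l.[x] * f.[x] by rewrite !hornerE.
have ka : k.[a] < 0.
  by rewrite kE la mulrDl divfK ?gt_eqF// opprD addrA subrr add0r oppr_lt0 mulr_gt0.
have kb : 0 < k.[b].
  by rewrite kE lb mulrBl divfK ?gt_eqF// opprB addrC subrK mulr_gt0.
have k0 : k != 0 by apply: contraTneq kb => ->; rewrite hornerC ltxx.
have k' x : a <= x <= b -> k.[x] = 0 -> k^`().[x] < 0.
  move=> /f_gt0 fx; rewrite kE => /eqP; rewrite subr_eq0 => /eqP gx.
  have := W_ge0 x; rewrite gx => Wx.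
  rewrite -(pmulr_rlt0 _ fx).
  have -> : k^`().[x] = g^`().[x] - (e / (b - a) * f.[x] + l.[x] * f^`().[x]).
    by rewrite /k derivB derivM hornerD hornerN hornerD !hornerM l'.
  have := mulr_gt0 (divr_gt0 e_gt0 ba) (mulr_gt0 fx fx).
  by move: Wx; set z := e / _ => Wx zf; nra.
have kab : k.[a] * k.[b] < 0 by rewrite nmulr_rlt0.
have [r rab kr] := poly_ivtoo (ltW ab) kab.
(* At the last root [y] before [b] the derivative is negative, so [k] is negative just after [y] but
   positive at [b], which forces a later root. *)
case: (prev_rootP k a b) => [/eqP|y _ ky yab y_last|c _ _ /(_ r rab)].
- by rewrite (negPf k0).
- have yb : y < b by rewrite (itvP yab).
  have [m m_nr] := neighpr_wit yb k0.
  have := sgr_neighpr m_nr; rewrite sgp_right_deriv; last by rewrite rootE ky.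
  have k'y : k^`().[y] < 0 by apply: k' => //; rewrite !(itvP yab).
  rewrite sgp_rightNroot ?rootE ?lt_eqF// (ltr0_sg k'y) => /eqP; rewrite sgr_cp0 => km.
  have ym : y < m by rewrite (itvP m_nr).
  have mb : m < b.
    apply: (@lt_le_trans _ _ (next_root k y b)); first by rewrite (itvP m_nr).
    by have nb := next_root_in k y b; rewrite (le_trans (y := Num.max b y)) ?(itvP nb)// max_l// ltW.
  have kmb : k.[m] * k.[b] < 0 by rewrite nmulr_rlt0.
  have [z zmb kz] := poly_ivtoo (ltW mb) kmb.
  have := y_last z; rewrite in_itv/= (lt_trans ym) ?(itvP zmb)// kz.
  by move=> /(_ isT).
- by rewrite kr.
Qed.

Lemma largest_root f (c : R) : 0 < lead_coef f -> f.[c] <= 0 ->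
  exists a, [/\ c <= a, f.[a] = 0 & forall t, a < t -> 0 < f.[t]].
Proof.
move=> lf fc; have [B fB] := poly_pinfty_gt_lc lf.
have f_gt0 t : B <= t -> 0 < f.[t] by move=> /fB; apply: lt_le_trans.
have f0 : f != 0 by rewrite -lead_coef_eq0 gt_eqF.
have cB : c < B.
  by rewrite ltNge; apply/negP => /f_gt0; rewrite ltNge fc.
have [r rcB fr] := polyrcf.poly_ivt (ltW cB) (mulr_le0_ge0 fc (ltW (f_gt0 _ (lexx B)))).
have rB : r < B.
  rewrite lt_neqAle (itvP rcB) andbT; apply: contraTneq fr => ->.
  by rewrite rootE gt_eqF ?f_gt0.
(* The interval is open and [r] may equal [c], hence the left end [c - 1]. *)
have rI : r \in `]c - 1, B[.
  rewrite in_itv/= rB andbT; have : c <= r by rewrite (itvP rcB).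
  move=> cr; lra.
case: (prev_rootP f (c - 1) B) => [/eqP|y _ fy yI y_last|x _ _ /(_ r rI)].
- by rewrite (negPf f0).
- exists y; split=> //.
    apply: (@le_trans _ _ r); first by rewrite (itvP rcB).
    rewrite leNgt; apply/negP => yr.
    by have := y_last r; rewrite in_itv/= yr rB fr => /(_ isT).
  move=> t yt; have [/f_gt0//|tB] := leP B t.
  rewrite ltNge; apply/negP => ft.
  have [z zI fz] := polyrcf.poly_ivt (ltW tB) (mulr_le0_ge0 ft (ltW (f_gt0 _ (lexx B)))).
  have zB : z < B.
    rewrite lt_neqAle (itvP zI) andbT; apply: contraTneq fz => ->.
    by rewrite rootE gt_eqF ?f_gt0.
  have := y_last z; rewrite in_itv/= zB andbT (lt_le_trans yt) ?(itvP zI)// fz.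
  by move=> /(_ isT).
- by rewrite fr.
Qed.

Lemma horner_ge0_closed f (a : R) : (forall t : R, a < t -> 0 <= f.[t]) -> 0 <= f.[a].
Proof.
move=> f_ge0; rewrite leNgt; apply/negP => fa.
have Nfa : 0 < - f.[a] by rewrite oppr_gt0.
have [d d_gt0 fd] := poly_cont a f Nfa.
have d2 : 0 < d / 2 by lra.
have /f_ge0 fad : a < a + d / 2 by lra.
have := fd (a + d / 2); rewrite addrAC subrr add0r gtr0_norm// => fd2.
have /fd2 : d / 2 < d by lra.
by rewrite ltr_norml; lra.
Qed.

Section Ray.
Variables (f g : {poly R}) (a : R).
Hypotheses (size_fg : (size g < size f)%N) (lead_f : 0 < lead_coef f).
Hypothesis W_ge0 : forall x, 0 <= f^`().[x] * g.[x] - f.[x] * g^`().[x].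
Hypothesis f_gt0 : forall t, a < t -> 0 < f.[t].

Lemma ratio_nonincreasing_ray s t : a < s -> s <= t ->
  g.[t] * f.[s] <= g.[s] * f.[t].
Proof.
move=> a_s st; apply: ratio_nonincreasing => // x /andP[sx _].
by apply: f_gt0; apply: lt_le_trans sx.
Qed.

(** The nonincreasing ratio [g / f] tends to 0 because [g] has smaller degree. Were it [- c] at [t]
    with [c > 0], then [g + c *: f] would be at most 0 from [t] on, against its positive leading
    coefficient. *)
Lemma ratio_ge0_ray t : a < t -> 0 <= g.[t].
Proof.
move=> at_; rewrite leNgt; apply/negP => gt0.
have ft := f_gt0 at_.
pose c := - g.[t] / f.[t]; have c_gt0 : 0 < c by rewrite divr_gt0 ?oppr_gt0.
have lc : lead_coef (g + c *: f) = c * lead_coef f.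
  by rewrite lead_coefDr ?size_scale ?gt_eqF// lead_coefZ.
have [|B /(_ (Num.max t B))] := @poly_pinfty_gt_lc _ (g + c *: f).
  by rewrite lc mulr_gt0.
rewrite le_max lexx orbT lc => /(_ isT); set u := Num.max t B.
have tu : t <= u by rewrite le_max lexx.
rewrite leNgt => /negP; apply.
apply: le_lt_trans (_ : 0 < _); last by rewrite mulr_gt0.
rewrite hornerD hornerZ /c -(pmulr_lle0 _ ft) mulrDl.
rewrite mulrAC -[X in _ + X]mulrA (mulrC _ f.[t]) [X in _ + X]mulrA divfK ?gt_eqF//.
by have := ratio_nonincreasing_ray at_ tu; lra.
Qed.
End Ray.

(** Here [f] interlaces both [p] and [q]. If [f] is nonpositive somewhere on the ray from [s], then
    at its largest root [g] and [h] are nonnegative, so [p] and [q] are both nonpositive there.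
    Otherwise [h / f] is nonincreasing from [s] on; it is at least 1 at [t], hence at [s], so [q] is
    nonpositive at [s] as well. *)
Lemma interlaced_sum_le0 f p q (s t : R) :
    let g := f - p in let h := f - q in
    (size g < size f)%N -> (size h < size f)%N -> 0 < lead_coef f ->
    (forall x, 0 <= f^`().[x] * g.[x] - f.[x] * g^`().[x]) ->
    (forall x, 0 <= f^`().[x] * h.[x] - f.[x] * h^`().[x]) ->
    s <= t -> p.[s] <= 0 -> q.[t] <= 0 ->
  exists2 u, s <= u & p.[u] + q.[u] <= 0.
Proof.
move=> g h sg sh lf Wg Wh st ps qt.
have gE x : g.[x] = f.[x] - p.[x] by rewrite hornerD hornerN.
have hE x : h.[x] = f.[x] - q.[x] by rewrite hornerD hornerN.
have [[c [sc fc]]|f_gt0] := pselect (exists c, s <= c /\ f.[c] <= 0).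
  have [a [ca fa fpos]] := largest_root lf fc.
  exists a; first exact: le_trans sc ca.
  have ga : 0 <= g.[a] by apply: horner_ge0_closed => x; exact: ratio_ge0_ray fpos x.
  have ha : 0 <= h.[a] by apply: horner_ge0_closed => x; exact: ratio_ge0_ray fpos x.
  by move: ga ha; rewrite gE hE fa; lra.
have {}f_gt0 x : s <= x -> 0 < f.[x].
  by move=> sx; rewrite ltNge; apply/negP => fx; apply: f_gt0; exists x.
exists s => //; suff : f.[s] <= h.[s] by rewrite hE; lra.
have hst : h.[t] * f.[s] <= h.[s] * f.[t].
  by apply: ratio_nonincreasing => // x /andP[/f_gt0].
have [fs ft] := (f_gt0 s (lexx s), f_gt0 t st).
have fht : f.[t] <= h.[t] by rewrite hE; lra.
rewrite -(ler_pM2r ft) mulrC; apply: le_trans hst.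
by rewrite ler_pM2r.
Qed.
End RealPolynomials.

(** * Averages over random rank one matrices *)

Section ChoiceSum.
Variable F : comNzRingType.

(** Bordering [M] by the column [u] and the row [(1, w *: v)] does not change this determinant,
    which is then linear in the bordering row and so affine in [w]. *)
Lemma det_rank1 n (M : 'M[F]_n) (u : 'cV_n) (v : 'rV_n) :
  exists b, forall w, \det (M - w *: (u *m v)) = \det M - w * b.
Proof.
pose B (a : F) (r : 'rV_n) : 'M_(1 + n) := block_mx a%:M r u M.
exists (- \det (B 0 v)) => w; rewrite mulrN opprK.
have -> : \det (M - w *: (u *m v)) = \det (B 1 (w *: v)).
  have -> : B 1 (w *: v) = block_mx 1%:M 0 u 1%:M *m block_mx 1%:M (w *: v) 0 (M - w *: (u *m v)).
    rewrite mulmx_block !mul1mx !mulmx1 !mul0mx !addr0.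
    by rewrite -scalemxAr addrC subrK.
  by rewrite det_mulmx det_lblock det_ublock !det1 !mul1r.
have -> : \det M = \det (B 1 0) by rewrite det_lblock det1 mul1r.
rewrite -[X in X + _]mul1r.
apply: (@determinant_multilinear _ _ _ _ _ (lshift n ord0)).
- rewrite !rowKu !row_row_mx !scale_row_mx add_row_mx !scale1r !raddf0 add0r.
  congr row_mx; apply/rowP => i; rewrite !mxE //.
  by rewrite addr0.
all: apply/matrixP => i j; rewrite !mxE; case: splitP => k; last by rewrite !mxE.
all: by rewrite [k]ord1.
Qed.

(* A triple (w, (u, v)) is a random rank one matrix: w u u^T or w v v^T. *)
Fixpoint choice_sum n (l : seq (F * ('cV[F]_n * 'cV[F]_n))) (M : 'M[F]_n) : F :=
  if l is (w, (u, v)) :: l' then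
    choice_sum l' (M - w *: (u *m u^T)) + choice_sum l' (M - w *: (v *m v^T))
  else \det M.

(** A sum of determinants is still affine in the coefficient of a rank one change; the slope is read
    off from the values at 0 and 1. *)
Lemma choice_sum_rank1 n l (M : 'M[F]_n) (u : 'cV_n) w :
  choice_sum l (M - w *: (u *m u^T)) =
  choice_sum l M - w * (choice_sum l M - choice_sum l (M - u *m u^T)).
Proof.
elim: l M => [|[c [a b]] l IHl] M /=.
  have [b db] := det_rank1 M u u^T.
  by have := db 1; rewrite scale1r mul1r db => ->; rewrite subKr.
have swap (A B : 'M[F]_n) : M - A - B = M - B - A by rewrite addrAC.
rewrite !(swap (w *: _) (c *: _)) !(swap (u *m u^T) (c *: _)) !IHl.
move: (choice_sum l _) (choice_sum l _) (choice_sum l _) (choice_sum l _) => p q r s.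
ring.
Qed.
End ChoiceSum.

Definition map_choice (F G : comNzRingType) (f : F -> G) n (x : F * ('cV[F]_n * 'cV[F]_n)) :=
  (f x.1, (map_mx f x.2.1, map_mx f x.2.2)).

Lemma choice_sum_map (F G : comNzRingType) (f : {rmorphism F -> G}) n l (M : 'M[F]_n) :
  choice_sum (map (@map_choice F G f n) l) (map_mx f M) = f (choice_sum l M).
Proof.
elim: l M => [|[c [u v]] l IHl] M /=; first by rewrite det_map_mx.
rewrite rmorphD -!IHl !map_mxB !map_mxZ !map_mxM !map_trmx.
by [].
Qed.

(** * Stability of averaged determinants *)

Section Stability.
Variable R : rcfType.
Local Notation C := R[i].
Local Notation Re := (@complex.Re R).
Local Notation Im := (@complex.Im R).

(** The matrix analogue of the upper half-plane: the anti-Hermitian part of [M] is [i] times a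
    positive definite Hermitian matrix. *)
Definition im_form_pos n (M : 'M[C]_n) :=
  forall x : 'cV_n, x != 0 -> 0 < Im ((map_mx (@conjc R) x^T *m M *m x) 0 0).

Lemma im_form_pos_det n (M : 'M[C]_n) : im_form_pos M -> \det M != 0.
Proof.
move=> M_pos; apply/negP => /det0P[v v0 vM].
have := M_pos (map_mx (@conjc R) v^T).
have -> : map_mx (@conjc R) (map_mx (@conjc R) v^T)^T = v.
  by apply/rowP => i; rewrite !mxE conjcK.
rewrite vM mul0mx mxE/= => M_false.
suff /M_false : map_mx (@conjc R) v^T != 0.
  by rewrite /= ltxx.
apply: contraNneq v0 => v0.
apply/eqP/rowP => i; have := congr1 (fun A : 'cV_n => A i 0) v0.
by rewrite !mxE => /eqP; rewrite conjc_eq0 => /eqP.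
Qed.

(** Since [u] is real, the form of [u *m u^T] at [x] is the squared modulus of [u^T *m x], a
    nonnegative real number. *)
Lemma im_form_pos_sub n (M : 'M[C]_n) (u : 'cV[R]_n) (w : C) :
  im_form_pos M -> Im w <= 0 ->
  im_form_pos (M - w *: (map_mx (real_complex R) u *m (map_mx (real_complex R) u)^T)).
Proof.
move=> M_pos w_le0 x x0; set uC := map_mx _ u.
rewrite mulmxBr mulmxBl [X in Im X]mxE [X in _ + X]mxE.
set z := (uC^T *m x) 0 0.
have -> : (map_mx (@conjc R) x^T *m (w *: (uC *m uC^T)) *m x) 0 0 = w * (z^*%C * z).
  rewrite -scalemxAr -scalemxAl mxE (mulmxA _ uC) -(mulmxA _ _ x); congr (w * _).
  have -> : map_mx (@conjc R) x^T *m uC = (z^*%C)%:M.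
    apply/matrixP => i j; rewrite !ord1 [RHS]mxE mulr1n /z.
    rewrite ![in RHS]mxE rmorph_sum mxE; apply: eq_bigr => k _.
    by rewrite !mxE rmorphM/= oppr0 mulrC.
  by rewrite mul_scalar_mx mxE.
have := M_pos x x0; set m := _ 0 0 => m_gt0.
have -> : z^*%C * z = (Re z ^+ 2 + Im z ^+ 2)%:C%C.
  by case: z => a b; apply/eqP; rewrite eq_complex/=; apply/andP; split; apply/eqP; ring.
have -> : Im (m - w * (Re z ^+ 2 + Im z ^+ 2)%:C%C) = Im m - Im w * (Re z ^+ 2 + Im z ^+ 2).
  by case: m {m_gt0} w {w_le0} => [a b] [c d] /=; ring.
have : 0 <= Re z ^+ 2 + Im z ^+ 2 by rewrite addr_ge0 ?sqr_ge0.
by move: (Re z ^+ 2 + _) => r r0; nra.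
Qed.

Local Notation toC := (map (@map_choice R C (real_complex R) _)).

(** By affinity each summand equals [a - w * (c * a)], where [a] is the average without the new
    term. If [c] is nonzero with [Im c >= 0], then [1 / c] is an allowed coefficient at which the
    average vanishes, against the induction hypothesis; so [c = 0] or [Im c < 0]. With two such
    numbers [2 - w * (cu + cv)] cannot vanish. *)
Lemma choice_sum_stable n (l : seq (R * ('cV[R]_n * 'cV[R]_n))) (M : 'M[C]_n) :
  all (fun x => 0 <= x.1) l -> im_form_pos M -> choice_sum (toC l) M != 0.
Proof.
elim: l M => [|[w [u v]] l IHl] M /=; first by move=> _; exact: im_form_pos_det.
move=> /andP[w_ge0 /IHl{}IHl] M_pos; set uC := map_mx _ u; set vC := map_mx _ v.
set a := choice_sum (toC l) M.
have a0 : a != 0 by exact: IHl.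
have root_im (r : 'cV[R]_n) : let rC := map_mx (real_complex R) r in
    exists2 c : C, (c == 0) || (Im c < 0) &
      choice_sum (toC l) (M - w%:C%C *: (rC *m rC^T)) = a - w%:C%C * (c * a).
  move=> rC; exists ((a - choice_sum (toC l) (M - rC *m rC^T)) / a); last first.
    by rewrite choice_sum_rank1 divfK.
  set c := (X in X == 0); have [//|c0 /=] := eqVneq c 0.
  rewrite ltNge; apply/negP; rewrite -/c => c_ge0.
  have im_w : Im c^-1 <= 0.
    case Ec: c c_ge0 {c0} => [p q] /= q_ge0.
    by rewrite oppr_le0 divr_ge0// addr_ge0 ?sqr_ge0.
  have := IHl _ (im_form_pos_sub r M_pos im_w).
  rewrite choice_sum_rank1 -/a -/rC -[_ - choice_sum _ _](divfK a0) -/c.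
  by rewrite mulKf// subrr eqxx.
have [cu cu_le Eu] := root_im u; have [cv cv_le Ev] := root_im v.
suff : a - w%:C%C * (cu * a) + (a - w%:C%C * (cv * a)) != 0.
  by rewrite -(congr2 +%R Eu Ev).
rewrite (_ : _ + _ = (2 - w%:C%C * (cu + cv)) * a); last by ring.
rewrite mulf_neq0//; apply/eqP => eq0.
have im0 : w * (Im cu + Im cv) = 0.
  have := congr1 Im eq0; case: (cu) (cv) => [p q] [p' q'] /= E.
  by move: E; lra.
have re0 : 2 - w * (Re cu + Re cv) = 0.
  have := congr1 Re eq0; case: (cu) (cv) => [p q] [p' q'] /= E.
  by move: E; lra.
have [w0|w_neq0] := eqVneq w 0; first by move: re0; rewrite w0; lra.
have w_gt0 : 0 < w by rewrite lt_neqAle eq_sym w_neq0.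
move/eqP: im0; rewrite mulf_eq0 (negPf w_neq0)/= => /eqP im0.
case/orP: cu_le => [/eqP cu0|cu_lt0]; case/orP: cv_le => [/eqP cv0|cv_lt0].
- by move: re0; rewrite cu0 cv0 /=; lra.
- by move: im0; rewrite cu0 /=; lra.
- by move: im0; rewrite cv0 /=; lra.
- by move: im0; lra.
Qed.
End Stability.

(** * From stability to Wronskians *)

Section ChoicePolynomial.
Variable R : rcfType.
Local Notation C := R[i].
Local Notation Re := (@complex.Re R).
Local Notation Im := (@complex.Im R).
Local Notation "p ^C" := (map_poly (real_complex R) p).

Lemma horner_complex_expansion (p : {poly R}) x : exists A B : {poly R}, forall e,
  p^C.[x +i* e]%C =
  ((p.[x] + e ^+ 2 * A.[e]) +i* (e * p^`().[x] + e ^+ 2 * B.[e]))%C.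
Proof.
elim/poly_ind: p => [|p c [A [B AB]]].
  by exists 0, 0 => e; rewrite rmorph0 deriv0 !hornerC !mulr0 addr0.
exists (x *: A - p^`().[x]%:P - 'X * B), ('X * A + x *: B) => e.
have -> : (p * 'X + c%:P)^C = p^C * 'X + (c%:C%C)%:P.
  by rewrite rmorphD rmorphM/= map_polyX map_polyC.
rewrite [LHS]hornerMXaddC AB.
rewrite derivD derivM derivX derivC addr0 mulr1 !hornerE.
by apply/eqP; rewrite eq_complex/=; apply/andP; split; apply/eqP; ring.
Qed.

(** The hypothesis says that [f / g] has positive imaginary part at points of the upper half-plane
    where [g] is nonzero. Approaching the real point [x] vertically, the first order term of the
    imaginary part of [f] times the conjugate of [g] is the Wronskian. *)
Lemma wronskian_ge0 (f g : {poly R}) :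
    (forall z w : C, 0 < Im z -> Im w <= 0 -> f^C.[z] - w * g^C.[z] != 0) ->
  forall x, 0 <= f^`().[x] * g.[x] - f.[x] * g^`().[x].
Proof.
move=> stable x.
have [A [B fE]] := horner_complex_expansion f x.
have [A' [B' gE]] := horner_complex_expansion g x.
(* [e * P.[e]] is the imaginary part of [f] times the conjugate of [g] at [x + i e], and [P.[0]] is
   the Wronskian. *)
pose P := (f^`().[x] * g.[x] - f.[x] * g^`().[x])%:P
  + 'X * (g.[x] *: B - f.[x] *: B' + 'X * (f^`().[x] *: A' - g^`().[x] *: A)
  + 'X^2 * (B * A' - A * B')).
suff : 0 <= P.[0] by rewrite /P !hornerE.
apply: horner_ge0_closed => e e_gt0.
have : 0 <= Im (f^C.[x +i* e]%C * (g^C.[x +i* e]%C)^*%C).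
  have := stable (x +i* e)%C; move: (f^C.[_]) (g^C.[_]) => fz gz /= /(_ _ e_gt0) fgz.
  rewrite leNgt; apply/negP => im_lt0.
  have gz0 : gz != 0 by apply: contraTneq im_lt0 => ->; rewrite conjc0 mulr0 ltxx.
  suff /fgz : Im (fz / gz) <= 0 by rewrite divfK// subrr eqxx.
  case: gz fz {fgz} gz0 im_lt0 => [a b] [c d] ab0 /= im_lt0.
  have ab_gt0 : 0 < a ^+ 2 + b ^+ 2.
    rewrite lt_neqAle addr_ge0 ?sqr_ge0// andbT eq_sym paddr_eq0 ?sqr_ge0//.
    by rewrite !sqrf_eq0; move: ab0; rewrite eq_complex.
  rewrite (_ : _ + _ = (c * - b + d * a) / (a ^+ 2 + b ^+ 2)); last by ring.
  by rewrite ltW// pmulr_llt0 ?invr_gt0.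
rewrite fE gE /= => im_ge0; rewrite -(pmulr_rge0 _ e_gt0).
rewrite [X in 0 <= X](_ : _ = (f.[x] + e ^+ 2 * A.[e]) * - (e * g^`().[x] + e ^+ 2 * B'.[e]) +
   (e * f^`().[x] + e ^+ 2 * B.[e]) * (g.[x] + e ^+ 2 * A'.[e])) //.
rewrite /P !hornerE; ring.
Qed.

Local Notation toC := (map (@map_choice R C (real_complex R) _)).
Local Notation toP := (map (@map_choice R {poly R} (@polyC R) _)).

(** Up to the factor [2 ^+ size l], the expected characteristic polynomial of the random sum of rank
    one matrices minus [M]. *)
Definition choice_poly n (l : seq (R * ('cV[R]_n * 'cV[R]_n))) (M : 'M[R]_n) : {poly R} :=
  choice_sum (toP l) ('X%:M + map_mx (@polyC R) M).

Lemma choice_poly_horner n l (M : 'M[R]_n) t :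
  (choice_poly l M).[t] = choice_sum l (t%:M + M).
Proof.
rewrite -horner_evalE /choice_poly -choice_sum_map -map_comp map_mxD map_scalar_mx/=.
rewrite horner_evalE hornerX -map_mx_comp; congr choice_sum.
  rewrite -[RHS]map_id; apply: eq_map => -[w [u v]].
  rewrite /map_choice/= horner_evalE hornerC -!map_mx_comp; congr (_, (_, _)).
    by apply: map_mx_id => y;  rewrite /= horner_evalE hornerC.
  by apply: map_mx_id => y;  rewrite /= horner_evalE hornerC.
by congr (_ + _); apply: map_mx_id => y;  rewrite /= horner_evalE hornerC.
Qed.

Lemma choice_poly_complex n l (M : 'M[R]_n) z :
  (choice_poly l M)^C.[z] = choice_sum (toC l) (z%:M + map_mx (real_complex R) M).
Proof.
rewrite -horner_evalE /choice_poly -!choice_sum_map -!map_comp !map_mxD !map_scalar_mx/=.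
rewrite map_polyX horner_evalE hornerX -!map_mx_comp; congr choice_sum.
  apply: eq_map => -[w [u v]].
  rewrite /map_choice/= map_polyC horner_evalE hornerC -!map_mx_comp; congr (_, (_, _)).
    by apply: eq_map_mx => y; rewrite /= map_polyC horner_evalE hornerC.
  by apply: eq_map_mx => y; rewrite /= map_polyC horner_evalE hornerC.
by congr (_ + _); apply: eq_map_mx => y; rewrite /= map_polyC horner_evalE hornerC.
Qed.
End ChoicePolynomial.

(** * Selecting one summand of an average *)

Section Selection.
Variable R : rcfType.
Local Notation C := R[i].
Local Notation Re := (@complex.Re R).
Local Notation Im := (@complex.Im R).
Local Notation "p ^C" := (map_poly (real_complex R) p).
Local Notation toC := (map (@map_choice R C (real_complex R) _)).

(** The leading term depends only on the number of choices, so the difference of two such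
    polynomials drops in degree, as interlacing requires. *)
Lemma choice_poly_coef n l (M : 'M[R]_n) j : (n <= j)%N ->
  (choice_poly l M)`_j = 2 ^+ size l * (j == n)%:R.
Proof.
move=> nj; elim: l M => [|[w [u v]] l IHl] M.
  rewrite /choice_poly/= expr0 mul1r.
  have -> : 'X%:M + map_mx (@polyC R) M = char_poly_mx (- M).
    by rewrite /char_poly_mx map_mxN opprK.
  rewrite -/(char_poly (- M)); have sz := size_char_poly (- M).
  have [->|jn] := eqVneq j n.
    by have := monicP (char_poly_monic (- M)); rewrite lead_coefE sz.
  by rewrite nth_default// sz ltn_neqAle eq_sym jn.
have -> : choice_poly ((w, (u, v)) :: l) M =
    choice_poly l (M - w *: (u *m u^T)) + choice_poly l (M - w *: (v *m v^T)).
  rewrite /choice_poly/= !map_mxB !map_mxZ !map_mxM !map_trmx !addrA.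
  by [].
by rewrite coefD !IHl exprS -mulrA mulr2n mulrDl mul1r.
Qed.

Lemma size_choice_poly n l (M : 'M[R]_n) : size (choice_poly l M) = n.+1.
Proof.
apply/eqP; rewrite eqn_leq; apply/andP; split.
  by apply/leq_sizeP => j nj; rewrite choice_poly_coef 1?ltnW// gtn_eqF// mulr0.
rewrite ltnNge; apply/negP => /leq_sizeP/(_ n (leqnn n))/eqP.
by rewrite choice_poly_coef// eqxx mulr1 expf_eq0 pnatr_eq0 andbF.
Qed.

Lemma lead_coef_choice_poly n l (M : 'M[R]_n) : 0 < lead_coef (choice_poly l M).
Proof.
by rewrite lead_coefE size_choice_poly choice_poly_coef// eqxx mulr1 exprn_gt0.
Qed.

Lemma im_form_pos_shift n (M : 'M[R]_n) (z : C) : M^T = M -> 0 < Im z ->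
  im_form_pos (z%:M + map_mx (real_complex R) M).
Proof.
move=> M_sym z_gt0 x x0; rewrite mulmxDr mulmxDl [X in Im X]mxE.
rewrite mul_mx_scalar -scalemxAl [X in X + _]mxE.
set y := (_ *m map_mx _ M *m _) 0 0.
have y_real : Im y = 0.
  have : y^*%C = y.
    rewrite /y -[in RHS](trmxK (_ *m x)) [in RHS]mxE !trmx_mul map_trmx M_sym mulmxA.
    rewrite !mxE rmorph_sum; apply: eq_bigr => i _.
    rewrite rmorphM !mxE rmorph_sum; congr (_ * _).
      by apply: eq_bigr => j _; rewrite !mxE rmorphM /= conjcK oppr0.
  case: (y) => a b [/eqP]; rewrite eq_sym -subr_eq0 opprK => /eqP; rewrite /=; lra.
set r := (_ *m x) 0 0.
have -> : r = (\sum_i (Re (x i 0) ^+ 2 + Im (x i 0) ^+ 2))%:C%C.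
  rewrite /r mxE rmorph_sum; apply: eq_bigr => i _; rewrite !mxE.
  by case: (x i 0) => a b; apply/eqP; rewrite eq_complex/=; apply/andP; split; apply/eqP; ring.
have : 0 < \sum_i (Re (x i 0) ^+ 2 + Im (x i 0) ^+ 2).
  rewrite lt_neqAle sumr_ge0 ?andbT; last by move=> i _; rewrite addr_ge0 ?sqr_ge0.
  apply: contra x0; rewrite eq_sym psumr_eq0; last by move=> i _; rewrite addr_ge0 ?sqr_ge0.
  move=> /allP xi0; apply/eqP/colP => i; rewrite mxE.
  have := xi0 i (mem_index_enum i); rewrite paddr_eq0 ?sqr_ge0// !sqrf_eq0.
  by case: (x i 0) => a b /= /andP[/eqP-> /eqP->].
set s := \sum_i _ => s_gt0.
have -> : Im (z * s%:C%C + y) = Im z * s + Im y.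
  by case: (z) (y) => [a b] [c d] /=; ring.
by rewrite y_real addr0 mulr_gt0.
Qed.

(** By affinity [f - y g] is the averaged polynomial of [M] with the coefficient [y * w] on
    [u *m u^T]. This coefficient has nonpositive imaginary part whenever [y] has, so stability
    applies. *)
Lemma choice_poly_wronskian n l (M : 'M[R]_n) (u : 'cV_n) w :
    M^T = M -> all (fun x => 0 <= x.1) l -> 0 <= w ->
  let f := choice_poly l M in
  let g := f - choice_poly l (M - w *: (u *m u^T)) in
  forall x, 0 <= f^`().[x] * g.[x] - f.[x] * g^`().[x].
Proof.
move=> M_sym l_ge0 w_ge0 f g; apply: wronskian_ge0 => z y z_gt0 y_le0.
rewrite /g rmorphB hornerD hornerN !choice_poly_complex map_mxB map_mxZ map_mxM -map_trmx addrA.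
set N := z%:M + _; set uC := map_mx _ u; set L := toC l.
have := @choice_sum_rank1 _ _ L N uC w%:C%C => ->.
have N_pos : im_form_pos N by exact: im_form_pos_shift.
have yw : Im (y * w%:C%C) <= 0.
  by case: (y) y_le0 => a b /= b_le0; rewrite mulr0 add0r mulr_le0_ge0.
have := choice_sum_stable l_ge0 (im_form_pos_sub u N_pos yw).
by rewrite -/L choice_sum_rank1 opprB addrCA subrr addr0 mulrA.
Qed.

Fixpoint apply_choice n (l : seq (R * ('cV[R]_n * 'cV[R]_n))) (bs : seq bool) (M : 'M[R]_n) :=
  match l, bs with
  | (w, (u, v)) :: l', b :: bs' =>
      let r := if b then u else v in apply_choice l' bs' (M - w *: (r *m r^T))
  | _, _ => M
  end.

(* The largest root of one of the two summands of [choice_sum] is at most that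
   of the sum, because both are interlaced by the polynomial of M itself. *)
Theorem choice_selection n l (M : 'M[R]_n) :
    M^T = M -> all (fun x => 0 <= x.1) l ->
    (forall t : R, 0 <= t -> 0 < choice_sum l (t%:M + M)) ->
  exists2 bs, size bs = size l &
    forall t : R, 0 <= t -> 0 < \det (t%:M + apply_choice l bs M).
Proof.
elim: l M => [|[w [u v]] l IHl] M M_sym /=; first by move=> _ ?; exists [::].
move=> /andP[w_ge0 l_ge0] sum_gt0.
have sym (r : 'cV_n) : (M - w *: (r *m r^T))^T = M - w *: (r *m r^T).
  by rewrite linearB linearZ/= trmx_mul trmxK M_sym.
pose P (r : 'cV_n) (t : R) := 0 < (choice_poly l (M - w *: (r *m r^T))).[t].
suff [pos|pos] : (forall t : R, 0 <= t -> P u t) \/ (forall t : R, 0 <= t -> P v t).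
- have [|bs sz bsP] := IHl _ (sym u) l_ge0.
    by move=> t /pos; rewrite /P choice_poly_horner.
  by exists (true :: bs) => //=; rewrite sz.
- have [|bs sz bsP] := IHl _ (sym v) l_ge0.
    by move=> t /pos; rewrite /P choice_poly_horner.
  by exists (false :: bs) => //=; rewrite sz.
apply: contrapT => /not_orP[/existsNP[s /not_implyP[s0 Ps]] /existsNP[t /not_implyP[t0 Pt]]].
move/negP: Ps; move/negP: Pt; rewrite /P -!leNgt => Pt Ps.
set f := choice_poly l M.
set fu := choice_poly l (M - w *: (u *m u^T)) in Ps.
set fv := choice_poly l (M - w *: (v *m v^T)) in Pt.
have size_lt (r : 'cV_n) : (size (f - choice_poly l (M - w *: (r *m r^T)))%R < size f)%N.
  rewrite size_choice_poly ltnS; apply/leq_sizeP => j nj.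
  by rewrite coefB !choice_poly_coef// subrr.
have W r := @choice_poly_wronskian _ l M r w M_sym l_ge0 w_ge0.
have lf : 0 < lead_coef f by exact: lead_coef_choice_poly.
have sum0 x : 0 <= x -> 0 < fu.[x] + fv.[x].
  by move=> /sum_gt0; rewrite !choice_poly_horner !addrA.
have [st|ts] := leP s t.
  have [x sx] := interlaced_sum_le0 (size_lt u) (size_lt v) lf (W u) (W v) st Ps Pt.
  by rewrite leNgt sum0// (le_trans s0).
have [x sx] := interlaced_sum_le0 (size_lt v) (size_lt u) lf (W v) (W u) (ltW ts) Pt Ps.
by rewrite addrC leNgt sum0// (le_trans t0).
Qed.
End Selection.

(** * Principal minors *)

Section PrincipalMinors.
Variables (F : comNzRingType) (n : nat).
Implicit Types (A B N : 'M[F]_n) (S : {set 'I_n}).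

(* Padded with the identity outside S, so that \det (psub N S) is the principal
   minor of N on S. *)
Definition psub N S : 'M[F]_n :=
  \matrix_(i, j) if (i \in S) && (j \in S) then N i j else (i == j)%:R.

Lemma psub_tr N S : psub N^T S = (psub N S)^T.
Proof. by apply/matrixP => i j; rewrite !mxE andbC eq_sym. Qed.

Lemma cofactor_row A i j :
  cofactor A i j = \det (\matrix_(k, l) if k == i then (l == j)%:R else A k l).
Proof.
rewrite (expand_det_row _ i) (bigD1 j)//= big1 ?addr0 => [|l lj]; last first.
  by rewrite mxE eqxx (negPf lj) mul0r.
rewrite mxE !eqxx mul1r /cofactor; congr (_ * \det _).
by apply/matrixP => k l; rewrite !mxE eq_sym (negPf (neq_lift i k)).
Qed.

Lemma cofactor_col A i j :
  cofactor A i j = \det (\matrix_(k, l) if l == j then (k == i)%:R else A k l).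
Proof.
rewrite -det_tr -cofactor_tr cofactor_row; congr (\det _).
by apply/matrixP => k l; rewrite !mxE.
Qed.

Lemma eq_cofactor A B i j :
  (forall k l, k != i -> l != j -> A k l = B k l) -> cofactor A i j = cofactor B i j.
Proof.
move=> AB; rewrite /cofactor; congr (_ * \det _).
by apply/matrixP => k l; rewrite !mxE; apply: AB; rewrite eq_sym neq_lift.
Qed.

Lemma det_unit_col A i : (forall k, A k i = (k == i)%:R) -> \det A = cofactor A i i.
Proof.
move=> Ai; rewrite (expand_det_col _ i) (bigD1 i)//= big1 ?addr0 => [|l li].
  by rewrite Ai eqxx mul1r.
by rewrite Ai (negPf li) mul0r.
Qed.

Lemma adj_psub_diag N S y : y \in S -> \adj (psub N S) y y = \det (psub N (S :\ y)).
Proof.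
move=> yS; rewrite mxE (@det_unit_col (psub N (S :\ y)) y) => [|k]; last first.
  by rewrite mxE !inE eqxx andbF.
by apply: eq_cofactor => k l ky ly; rewrite !mxE !inE ky ly.
Qed.

(** An off-diagonal adjugate entry is a sum over paths from [y] to [z]; this splits off the first
    step. The sign comes from exchanging the rows [y] and [z]. *)
Lemma adj_psub_row N S y z : y \in S -> z \in S -> y != z ->
  \adj (psub N S) y z =
  - \sum_(u in S :\ y) N y u * \adj (psub N (S :\ y)) u z.
Proof.
move=> yS zS yz; rewrite mxE cofactor_col.
set C := (X in \det X); have CE k l : C k l = if l == y then (k == z)%:R else psub N S k l.
  by rewrite mxE.
rewrite (expand_det_row _ y) -sumrN [RHS]big_mkcond/=; apply: eq_bigr => u _.
rewrite CE !inE; have [->|uy]/= := eqVneq u y; first by rewrite (negPf yz) mul0r.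
rewrite mxE yS/=; case: ifP => uS; last by rewrite eq_sym (negPf uy) mul0r.
rewrite -mulrN mxE; congr (_ * _); rewrite !cofactor_row.
set P := (X in \det X = _); set Q := (X in _ = - \det X).
have PE k l : P k l = if k == y then (l == u)%:R else C k l by rewrite mxE.
have QE k l : Q k l = if k == z then (l == u)%:R else psub N (S :\ y) k l by rewrite mxE.
suff -> : \det Q = \det (xrow y z P).
  by rewrite xrowE det_mulmx det_perm odd_tperm yz expr1 mulN1r opprK.
rewrite (@det_unit_col Q y) => [|k]; last first.
  rewrite QE mxE !inE eqxx andbF/=; case: eqVneq => [->|//].
  by rewrite eq_sym (negPf uy) eq_sym (negPf yz).
rewrite (@det_unit_col (xrow y z P) y) => [|k]; last first.
  rewrite mxE PE CE eqxx; case: tpermP => [->|->|/eqP ky /eqP kz].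
  - by rewrite eq_sym (negPf yz) !eqxx.
  - by rewrite eqxx eq_sym (negPf uy) eq_sym (negPf yz).
  - by rewrite (negPf ky) (negPf kz).
apply: eq_cofactor => k l ky ly; rewrite QE [RHS]mxE PE CE.
have [->|kz] := eqVneq k z; first by rewrite tpermR eqxx.
rewrite tpermD; [|by rewrite eq_sym|by rewrite eq_sym].
by rewrite (negPf ky) (negPf ly) !mxE !inE ky ly.
Qed.

Lemma adj_psub_col N S y z : y \in S -> z \in S -> y != z ->
  \adj (psub N S) y z =
  - \sum_(u in S :\ z) \adj (psub N (S :\ z)) y u * N u z.
Proof.
move=> yS zS yz.
have -> : \adj (psub N S) y z = \adj (psub N^T S) z y by rewrite psub_tr -trmx_adj [RHS]mxE.
rewrite adj_psub_row// 1?eq_sym//; congr (- _); apply: eq_bigr => u _.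
by rewrite psub_tr -trmx_adj mxE [in RHS]mulrC [X in _ * X]mxE.
Qed.

Lemma det_psub N S v : v \in S -> \det (psub N S) =
  N v v * \det (psub N (S :\ v)) -
  \sum_(u in S :\ v) \sum_(w in S :\ v) N v u * \adj (psub N (S :\ v)) u w * N w v.
Proof.
move=> vS; rewrite (expand_det_row _ v) (bigD1 v)//= mxE vS/= -[cofactor _ v v]/(_).
have -> : cofactor (psub N S) v v = \det (psub N (S :\ v)) by rewrite -adj_psub_diag// mxE.
congr (_ + _); rewrite -sumrN [RHS]big_mkcond [RHS](bigD1 v)//= !inE eqxx/= add0r.
apply: eq_bigr => u uv; rewrite mxE vS !inE uv/=.
case: ifP => uS; last by rewrite eq_sym (negPf uv) mul0r.
have -> : cofactor (psub N S) v u = \adj (psub N S) u v by rewrite mxE.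
rewrite adj_psub_col// mulrN mulr_sumr; congr (- _); apply: eq_bigr => w _.
by rewrite mulrA.
Qed.

End PrincipalMinors.

(** * Averages over signings *)

Section Signings.
Variables (R : realFieldType) (n : nat) (E : finType) (a b : E -> 'I_n) (w : E -> R).
Hypothesis ab : forall e, a e != b e.
Implicit Types (e f : E) (u v y z : 'I_n) (s : {ffun E -> bool}) (S : {set 'I_n}).

Definition joins e u v := (a e == u) && (b e == v) || (a e == v) && (b e == u).

Lemma joins_sym e u v : joins e u v = joins e v u.
Proof. exact: orbC. Qed.

Lemma joinsxx e v : joins e v v = false.
Proof. by apply/negP => /orP[]/andP[/eqP<- /eqP eb]; have := ab e; rewrite eb eqxx. Qed.

Lemma joins_end e u v y z : joins e u v -> joins e y z -> (y == u) || (y == v).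
Proof.
by move=> /orP[]/andP[/eqP<- /eqP<-] /orP[/andP[/eqP<- _]|/andP[_ /eqP<-]]; rewrite eqxx ?orbT.
Qed.

Lemma joins_inj e u y z : joins e u y -> joins e u z -> y = z.
Proof.
move=> uy; rewrite joins_sym => zu; have /orP[/eqP zu'|/eqP//] := joins_end uy zu.
by move: zu; rewrite zu' joinsxx.
Qed.

Definition sgn s e : R := (-1) ^+ s e.

Definition signed_adj s : 'M[R]_n :=
  \matrix_(i, j) \sum_e sgn s e * w e * (joins e i j)%:R.

Definition char_mx x s : 'M[R]_n := x%:M - signed_adj s.

Lemma signed_adj_tr s : (signed_adj s)^T = signed_adj s.
Proof. by apply/matrixP => i j; rewrite !mxE; apply: eq_bigr => e _; rewrite joins_sym. Qed.

Lemma char_mx_tr x s : (char_mx x s)^T = char_mx x s.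
Proof. by rewrite linearB/= tr_scalar_mx signed_adj_tr. Qed.

Lemma char_mx_diag x s v : char_mx x s v v = x.
Proof.
rewrite !mxE eqxx mulr1n big1 ?subr0// => e _.
by rewrite joinsxx mulr0.
Qed.

Lemma char_mx_off x s u v : u != v ->
  char_mx x s u v = - \sum_(e | joins e u v) sgn s e * w e.
Proof.
move=> uv; rewrite !mxE (negPf uv) mulr0n sub0r; congr (- _).
rewrite [RHS]big_mkcond; apply: eq_bigr => e _.
by case: ifP => _; rewrite ?mulr1 ?mulr0.
Qed.

Definition flip e s : {ffun E -> bool} := [ffun f => s f (+) (f == e)].

Lemma flipK e : involutive (flip e).
Proof. by move=> s; apply/ffunP => f; rewrite !ffunE -addbA addbb addbF. Qed.

Lemma sgn_flip e s f : sgn (flip e s) f = (if f == e then - sgn s f else sgn s f).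
Proof.
by rewrite /sgn ffunE; case: eqP => _; case: (s f); rewrite ?expr0 ?expr1 ?opprK.
Qed.

Lemma sgn2 s e : sgn s e * sgn s e = 1.
Proof. by rewrite /sgn -expr2 sqrr_sign. Qed.

(** Pairing [s] with [flip e s] cancels the sum. This is how averaging discards every term in which
    the sign of some edge occurs to an odd power. *)
Lemma sum_flip0 e (G : {ffun E -> bool} -> R) :
  (forall s, G (flip e s) = - G s) -> \sum_s G s = 0.
Proof.
move=> Gflip; have : \sum_s G s = - \sum_s G s.
  rewrite [LHS](reindex_inj (inv_inj (flipK e))) -sumrN.
  by apply: eq_bigr => s _; exact: Gflip.
by lra.
Qed.

Lemma psub_flip x e u v s S : joins e u v -> u \notin S ->
  psub (char_mx x (flip e s)) S = psub (char_mx x s) S.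
Proof.
move=> euv uS; apply/matrixP => i j; rewrite !mxE; case: ifP => // /andP[iS jS].
congr (_ - _); apply: eq_bigr => f _; have [eij|] := boolP (joins f i j); last by rewrite !mulr0.
rewrite sgn_flip; case: eqVneq => // fe; rewrite {f}fe in eij *.
have /orP[/eqP ui|/eqP uj] := joins_end eij euv.
- by rewrite ui iS in uS.
- by rewrite uj jS in uS.
Qed.

(** By the theorem of Godsil and Gutman this is [2 ^ #|E|] times the matching polynomial at [x] of
    the graph induced on [S], an edge [e] having weight [w e ^+ 2]. *)
Definition minor_sum x S : R := \sum_s \det (psub (char_mx x s) S).

Definition mult u v : R := \sum_(e | joins e u v) w e ^+ 2.

Lemma mult_sym u v : mult u v = mult v u.
Proof. by apply: eq_bigl => e; exact: joins_sym. Qed.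

Lemma multxx v : mult v v = 0.
Proof. by rewrite /mult big_pred0// => e; rewrite joinsxx. Qed.

(** Expansion along the row and the column of [v]. The factor [h] stays with the two edge signs, so
    that [sum_flip0] can be applied to each inner sum. *)
Lemma sum_psub_bilinear x S v (h : {ffun E -> bool} -> R) :
  v \in S ->
  \sum_s h s * \det (psub (char_mx x s) S) =
  x * \sum_s h s * \det (psub (char_mx x s) (S :\ v)) -
  \sum_(u in S :\ v) \sum_(y in S :\ v) \sum_(e | joins e v u) \sum_(f | joins f v y)
     w e * w f * \sum_s h s * (sgn s e * sgn s f) * \adj (psub (char_mx x s) (S :\ v)) u y.
Proof.
move=> vS; rewrite mulr_sumr.
under eq_bigr => s _ do rewrite (det_psub _ vS) char_mx_diag mulrBr mulrCA.
rewrite sumrB; congr (_ - _).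
under eq_bigr => s _ do rewrite mulr_sumr.
rewrite exchange_big; apply: eq_bigr => u uS.
under eq_bigr => s _ do rewrite mulr_sumr.
rewrite exchange_big; apply: eq_bigr => y yS.
have [uv yv] : v != u /\ y != v by move: uS yS; rewrite !inE eq_sym => /andP[-> _] /andP[-> _].
transitivity (\sum_s \sum_(e | joins e v u) \sum_(f | joins f v y)
   w e * w f * (h s * (sgn s e * sgn s f) * \adj (psub (char_mx x s) (S :\ v)) u y)).
  apply: eq_bigr => s _; rewrite !char_mx_off// mulNr mulrN mulNr opprK.
  rewrite mulr_suml mulr_suml mulr_sumr; apply: eq_bigr => e _.
  rewrite mulr_sumr mulr_sumr; apply: eq_big => [f|f _]; first exact: joins_sym.
  by ring.
rewrite exchange_big; apply: eq_bigr => e _; rewrite exchange_big; apply: eq_bigr => f _.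
by rewrite mulr_sumr.
Qed.

(** The matching recursion at [v]: an edge at [v] does not occur in the minor on [S :\ v], so a term
    survives the average only if its two edges at [v] coincide. *)
Lemma minor_sum_rec x S v : v \in S ->
  minor_sum x S = x * minor_sum x (S :\ v) -
    \sum_(u in S :\ v) mult v u * minor_sum x (S :\ v :\ u).
Proof.
move=> vS; have rec := sum_psub_bilinear x (fun=> 1) vS.
have mul1_sum T : \sum_s 1 * \det (psub (char_mx x s) T) = minor_sum x T.
  by apply: eq_bigr => s _; rewrite mul1r.
rewrite !mul1_sum in rec.
rewrite rec; congr (_ - _); apply: eq_bigr => u uS.
rewrite (bigD1 u)//= [X in _ + X]big1 ?addr0 => [|y /andP[yS yu]]; last first.
  apply: big1 => e evu; apply: big1 => f fvy; rewrite (sum_flip0 (e := e)) ?mulr0// => s.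
  rewrite !sgn_flip eqxx (psub_flip _ _ evu) ?inE ?eqxx//.
  case: eqVneq => [fe|_]; last by ring.
  by rewrite fe in fvy; rewrite (joins_inj evu fvy) eqxx in yu.
rewrite /mult mulr_suml; apply: eq_bigr => e evu.
rewrite (bigD1 e)//= [X in _ + X]big1 ?addr0 => [|f /andP[fvu fe]]; last first.
  rewrite (sum_flip0 (e := e)) ?mulr0// => s.
  rewrite !sgn_flip eqxx (psub_flip _ _ evu) ?inE ?eqxx// (negPf fe); ring.
congr (_ * _); apply: eq_bigr => s _.
by rewrite mul1r sgn2 mul1r adj_psub_diag.
Qed.

Fixpoint walk v (p : seq (E * 'I_n)) :=
  if p is (e, u) :: p' then joins e v u && walk u p' else true.

Definition sgnw s (p : seq (E * 'I_n)) : R := \prod_(q <- p) sgn s q.1.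

Lemma walk_notin e u v y p : joins e u v -> walk y p -> u \notin y :: unzip2 p ->
  e \notin unzip1 p.
Proof.
move=> euv; elim: p y => [//|[f t] p IHp] y /= /andP[fyt tp].
rewrite !inE !negb_or => /and3P[uy ut up]; rewrite (IHp _ tp) ?inE ?negb_or ?ut// andbT.
apply: contraTneq fyt => <-; apply/negP => /joins_end/(_ euv).
by rewrite (negPf uy) (negPf ut).
Qed.

Lemma sgnw_flip e s p : e \notin unzip1 p -> sgnw (flip e s) p = sgnw s p.
Proof.
rewrite /sgnw => ep; apply: eq_big_seq => q qp; rewrite sgn_flip ifN//.
by apply: contraNneq ep => <-; apply: map_f.
Qed.

Section Positivity.
Variable x : R.
Hypothesis w_ge0 : forall e, 0 <= w e.
Hypothesis minor_sum_ge0 : forall S, 0 <= minor_sum x S.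

(** At every step only the edge of the walk itself survives the average. What remains is the product
    of the weights along the walk times the minor sum on the vertices off the walk. *)
Lemma walk_sum_ge0 y p S : walk y p -> uniq (y :: unzip2 p) ->
    {subset y :: unzip2 p <= S} ->
  0 <= \sum_s sgnw s p * \adj (psub (char_mx x s) S) y (last y (unzip2 p)).
Proof.
elim: p y S => [|[e u] p IHp] y S.
  move=> _ _ /(_ y (mem_head _ _)) yS /=.
  apply: le_trans (minor_sum_ge0 (S :\ y)) _; rewrite le_eqVlt; apply/orP; left; apply/eqP.
  by apply: eq_bigr => s _; rewrite /sgnw big_nil mul1r adj_psub_diag.
move=> /= /andP[eyu up] /andP[yup upU] sub.
set z := last u _; have zp : z \in u :: unzip2 p by exact: mem_last.
have yS : y \in S by apply: sub; exact: mem_head.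
have zS : z \in S by apply: sub; rewrite inE zp orbT.
have yz : y != z by apply: contraNneq yup => ->.
have e_p : e \notin unzip1 p := walk_notin eyu up yup.
rewrite (_ : \sum_s _ = \sum_(t in S :\ y) \sum_(f | joins f y t)
   w f * \sum_s sgn s e * sgnw s p * sgn s f * \adj (psub (char_mx x s) (S :\ y)) t z).
  apply: sumr_ge0 => t tS; apply: sumr_ge0 => f fyt; rewrite mulr_ge0//.
  have [fe|fe] := eqVneq f e; last first.
    rewrite (sum_flip0 (e := e))// => s.
    by rewrite !sgn_flip eqxx (negPf fe) sgnw_flip// (psub_flip _ _ eyu) ?inE ?eqxx//; ring.
  rewrite {f}fe in fyt *; rewrite -{t tS fyt}(joins_inj eyu fyt).
  apply: le_trans (IHp u (S :\ y) up upU _) _ => [t tp|].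
    apply/setD1P; split; first by apply: contraNneq yup => <-.
    by apply: sub; rewrite inE tp orbT.
  rewrite le_eqVlt; apply/orP; left; apply/eqP; apply: eq_bigr => s _.
  by rewrite -/z -[LHS]mul1r -(sgn2 s e); ring.
under eq_bigr => s _ do rewrite (adj_psub_row _ yS zS yz) -sumrN mulr_sumr.
rewrite exchange_big; apply: eq_bigr => t tS.
have yt : y != t by move: tS; rewrite !inE eq_sym => /andP[].
under eq_bigr => s _ do rewrite char_mx_off// mulNr opprK mulr_suml mulr_sumr.
rewrite exchange_big; apply: eq_bigr => f fyt; rewrite mulr_sumr.
by apply: eq_bigr => s _; rewrite /sgnw big_cons; ring.
Qed.

(** Expanding at [v] leaves the path from [y] to the last vertex, whose contribution is nonnegative,
    and the expansion carries a minus sign. So fixing the sign -1 on a cycle can only raise the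
    average determinant. *)
Lemma cycle_sum_le0 v y e f p : joins e v y -> walk y p ->
    joins f (last y (unzip2 p)) v -> uniq (v :: y :: unzip2 p) -> e != f ->
  \sum_s sgn s e * sgnw s p * sgn s f * \det (char_mx x s) <= 0.
Proof.
set z := last y _ => evy yp fzv /andP[vyp ypU] ef.
have psubT s : psub (char_mx x s) setT = char_mx x s.
  by apply/matrixP => i j; rewrite !mxE !inE.
under eq_bigr => s _ do rewrite -[char_mx x s]psubT.
have vT : v \in [set: 'I_n] by rewrite inE.
have e_p := walk_notin evy yp vyp.
have fvz : joins f v z by rewrite joins_sym.
have f_p := walk_notin fvz yp vyp.
have vNT : v \notin [set: 'I_n] :\ v by rewrite !inE eqxx.
rewrite (sum_psub_bilinear _ _ vT) (sum_flip0 (e := e)); last first.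
  move=> s; rewrite !sgn_flip eqxx eq_sym (negPf ef) sgnw_flip// (psub_flip _ _ evy)//; ring.
rewrite mulr0 sub0r oppr_le0.
apply: sumr_ge0 => u uS; apply: sumr_ge0 => t tS; apply: sumr_ge0 => e' e'u.
apply: sumr_ge0 => f' f't; rewrite !mulr_ge0//.
have sub : {subset y :: unzip2 p <= [set: 'I_n] :\ v}.
  by move=> r rp; rewrite !inE andbT; apply: contraNneq vyp => <-.
have pos := walk_sum_ge0 yp ypU sub.
have adj_sym s : \adj (psub (char_mx x s) ([set: 'I_n] :\ v)) z y =
    \adj (psub (char_mx x s) ([set: 'I_n] :\ v)) y z.
  by rewrite -[in LHS](char_mx_tr x s) psub_tr -trmx_adj mxE.
(* A term survives only if [e'] and [f'] are [e] and [f] in one of the two orders, one for each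
   orientation of the cycle. The reverse order reduces to the other by symmetry of the adjugate. *)
have [ee'|ee'] := eqVneq e' e.
  rewrite {e'}ee' in e'u *; rewrite -{u uS e'u}(joins_inj evy e'u).
  have [ff'|ff'] := eqVneq f' f.
    rewrite {f'}ff' in f't *; rewrite -{t tS f't}(joins_inj fvz f't).
    apply: le_trans pos _; rewrite le_eqVlt; apply/orP; left; apply/eqP.
    by apply: eq_bigr => s _; rewrite -[LHS]mul1r -{1}(sgn2 s e) -[LHS]mul1r -{1}(sgn2 s f); ring.
  rewrite (sum_flip0 (e := f))// => s.
  by rewrite !sgn_flip eqxx (negPf ef) (negPf ff') sgnw_flip// (psub_flip _ _ fvz)//; ring.
have [fe'|fe'] := eqVneq f' e; last first.
  rewrite (sum_flip0 (e := e))// => s.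
  by rewrite !sgn_flip eqxx (eq_sym f) (negPf ef) (negPf ee') (negPf fe') sgnw_flip// (psub_flip _ _ evy)//; ring.
rewrite {f'}fe' in f't *; rewrite -{t tS f't}(joins_inj evy f't).
have [e'f|e'f] := eqVneq e' f.
  rewrite {e' ee'}e'f in e'u *; rewrite -{u uS e'u}(joins_inj fvz e'u).
  apply: le_trans pos _; rewrite le_eqVlt; apply/orP; left; apply/eqP.
  by apply: eq_bigr => s _; rewrite adj_sym -[LHS]mul1r -{1}(sgn2 s e) -[LHS]mul1r -{1}(sgn2 s f); ring.
rewrite (sum_flip0 (e := f))// => s.
by rewrite !sgn_flip eqxx (negPf ef) (negPf e'f) sgnw_flip// (psub_flip _ _ fvz)//; ring.
Qed.

End Positivity.
End Signings.

(** * Positivity of matching polynomials *)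

Section MatchingPositivity.
Variables (R : realFieldType) (T : finType) (m : T -> T -> R) (f : {set T} -> R) (x : R).
Variables c d : T.
Hypothesis m_sym : forall u v, m u v = m v u.
Hypothesis mxx : forall v, m v v = 0.
Hypothesis m_ge0 : forall u v, 0 <= m u v.
Hypothesis m_ge1 : forall u v, m u v != 0 -> 1 <= m u v.
Hypothesis m_cd : 4 <= m c d.
Hypothesis deg_c : \sum_u m c u <= 7.
Hypothesis deg_d : \sum_u m d u <= 7.
Hypothesis deg_le5 : forall v, v != c -> v != d -> \sum_u m v u <= 5.
Hypothesis x_ge4 : 4 <= x.
Hypothesis f_set0 : 0 < f set0.
Hypothesis f_rec : forall (S : {set T}) v, v \in S ->
  f S = x * f (S :\ v) - \sum_(u in S :\ v) m v u * f (S :\ v :\ u).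

Let deg (S : {set T}) v := \sum_(u in S) m v u.

Lemma deg_sub (A B : {set T}) v u : A \subset B -> u \in B -> u \notin A ->
  deg A v + m v u <= deg B v.
Proof.
move=> AB uB uA; rewrite addrC /deg.
rewrite (_ : m v u + _ = \sum_(t in u |: A) m v t); last by rewrite big_setU1.
have uAB : u |: A \subset B by rewrite subUset sub1set uB.
rewrite [leRHS](big_setID (u |: A))/= (setIidPr uAB) lerDl.
by apply: sumr_ge0 => t _; exact: m_ge0.
Qed.

Lemma deg_le_total (S : {set T}) v : deg S v <= \sum_u m v u.
Proof.
rewrite [leRHS](bigID (mem S))/= lerDl.
by apply: sumr_ge0 => t _; exact: m_ge0.
Qed.

Lemma deg_split_total (S : {set T}) v u : u \notin S -> deg S v + m v u <= \sum_u m v u.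
Proof.
move=> uS; apply: le_trans (deg_le_total setT v).
by apply: deg_sub => //; rewrite ?subsetT ?inE.
Qed.

Let sparse (S : {set T}) := ~~ ((c \in S) && (d \in S)).

Lemma deg_sparse S v : sparse S -> v \in S -> deg (S :\ v) v <= 5.
Proof.
move=> S_sparse vS; have [vc|vc] := eqVneq v c.
  rewrite {v}vc in vS *; have dS : d \notin S :\ c.
    by rewrite !inE negb_and; move: S_sparse; rewrite /sparse vS/= => ->; rewrite orbT.
  have h := deg_split_total c dS; have h7 := le_trans h deg_c.
  by rewrite -(lerD2r (m c d)); apply: le_trans h7 _; have := m_cd; lra.
have [vd|vd] := eqVneq v d.
  rewrite {v vc}vd in vS *; have cS : c \notin S :\ d.
    by rewrite !inE negb_and; move: S_sparse; rewrite /sparse vS andbT => ->; rewrite orbT.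
  have h := deg_split_total d cS; have h7 := le_trans h deg_d.
  by rewrite -(lerD2r (m d c)); apply: le_trans h7 _; have := m_cd; rewrite (m_sym d); lra.
exact: le_trans (deg_le_total _ _) (deg_le5 vc vd).
Qed.

(** The Heilmann-Lieb induction at [x >= 4]. With at most one end of the heavy edge present all
    degrees are at most 5, so the ratios stay at least [4 - 5 / 2]. *)
Lemma sparse_ratio S : sparse S ->
  0 < f S /\ forall v, v \in S -> (4 - deg (S :\ v) v / 2) * f (S :\ v) <= f S.
Proof.
have [k] := ubnP #|S|; elim: k => // k IHk in S *; rewrite ltnS => Sk S_sparse.
have sub_sparse v : sparse (S :\ v).
  by apply: contra S_sparse; rewrite !inE => /andP[/andP[_ ->] /andP[_ ->]].
have sub_card v : v \in S -> (#|S :\ v| < k)%N by move=> vS; move: Sk; rewrite (cardsD1 v) vS.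
have ratio v : v \in S -> (4 - deg (S :\ v) v / 2) * f (S :\ v) <= f S.
  move=> vS; have [fv_gt0 fv] := IHk _ (sub_card v vS) (sub_sparse v).
  rewrite (f_rec vS).
  suff h : \sum_(u in S :\ v) m v u * f (S :\ v :\ u) <= deg (S :\ v) v * (f (S :\ v) / 2).
    have hx : 4 * f (S :\ v) <= x * f (S :\ v) by rewrite ler_wpM2r// ltW.
    apply: le_trans (lerB hx h).
    by rewrite mulrBl lerD2l lerN2 mulrAC mulrA.
  rewrite /deg mulr_suml; apply: ler_sum => u uSv.
  have [->|muv] := eqVneq (m v u) 0; first by rewrite !mul0r.
  rewrite ler_wpM2l// ler_pdivlMr//.
  have uS : u \in S by move: uSv; rewrite !inE => /andP[].
  have vSu : v \in S :\ u by rewrite !inE vS andbT; move: uSv; rewrite !inE eq_sym => /andP[].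
  have sub : S :\ v :\ u \subset S :\ u by rewrite setSD// subD1set.
  have vN : v \notin S :\ v :\ u by rewrite !inE eqxx andbF.
  (* From a total of at most 5, [u] loses its neighbour [v] of weight at least 1. Degree 4 gives the
     ratio [4 - 4 / 2], that is, the factor [1 / 2] used above. *)
  have deg4 : deg (S :\ v :\ u) u <= 4.
    rewrite -(lerD2r (m u v)); apply: le_trans (deg_sub u sub vSu vN) _.
    apply: le_trans (deg_sparse S_sparse uS) _.
    by have := m_ge1 muv; rewrite m_sym; lra.
  have Svu_sparse : sparse (S :\ v :\ u).
    by apply: contra S_sparse; rewrite !inE => /andP[/and3P[_ _ ->] /and3P[_ _ ->]].
  have [|fu_gt0 _] := IHk _ _ Svu_sparse.
    by apply: leq_ltn_trans (sub_card v vS); rewrite subset_leq_card// subD1set.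
  by have := fv u uSv; move: (deg _ _) (f _) (f _) deg4 fu_gt0 => dd p q; nra.
split=> //; have [S0|[v vS]] := set_0Vmem S; first by rewrite S0.
have [fv_gt0 _] := IHk _ (sub_card v vS) (sub_sparse v).
apply: lt_le_trans (ratio v vS); rewrite mulr_gt0//.
by have := deg_sparse S_sparse vS; lra.
Qed.

(* Removing first both ends of the heavy edge c d leaves ratios bounded by
   (4 - 3/2)(4 - 3/2), which beats the weight 4 of that edge. *)
Lemma matching_positive S : 0 < f S.
Proof.
have [/andP[cS dS]|S_sparse] := boolP ((c \in S) && (d \in S)); last first.
  by have [] := sparse_ratio S_sparse.
have cd : c != d.
  by apply: contraTneq m_cd => cd; rewrite cd mxx -ltNge.
have dSc : d \in S :\ c by rewrite !inE eq_sym cd.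
have Sc_sparse : sparse (S :\ c) by rewrite /sparse !inE eqxx.
have [F_gt0 F_ratio] := sparse_ratio Sc_sparse.
rewrite (f_rec cS) subr_gt0; apply: lt_le_trans (_ : 4 * f (S :\ c) <= _); last first.
  by rewrite ler_wpM2r// ltW.
rewrite (bigD1 d)//=.
(* Without [c], the vertex [d] keeps weight at most 3, and [2 / 5] is the inverse of [4 - 3 / 2]. *)
have d_term : m c d * f (S :\ c :\ d) <= m c d * (2 / 5 * f (S :\ c)).
  rewrite ler_wpM2l//; have := F_ratio d dSc.
  have cN : c \notin S :\ c :\ d by rewrite !inE eqxx andbF.
  have deg3 : deg (S :\ c :\ d) d <= 3.
    have h := le_trans (deg_split_total d cN) deg_d.
    rewrite -(lerD2r (m d c)); apply: le_trans h _.
    by have := m_cd; rewrite (m_sym d); lra.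
  have [G_gt0 _] : 0 < f (S :\ c :\ d) /\ True.
    by split=> //; have [] := @sparse_ratio (S :\ c :\ d); rewrite /sparse ?inE ?eqxx ?andbF.
  by move: (deg _ _) (f _) (f _) deg3 G_gt0 => dd p q; nra.
have u_terms : \sum_(u in S :\ c | u != d) m c u * f (S :\ c :\ u) <=
    (7 - m c d) * (f (S :\ c) / 2).
  apply: (@le_trans _ _ ((\sum_(u in S :\ c | u != d) m c u) * (f (S :\ c) / 2))).
    rewrite mulr_suml; apply: ler_sum => u /andP[uSc ud].
    have [->|mcu] := eqVneq (m c u) 0; first by rewrite !mul0r.
    rewrite ler_wpM2l//; have := F_ratio u uSc.
    have cN : c \notin S :\ c :\ u by rewrite !inE eqxx andbF.
    have uc : u != c by move: uSc; rewrite !inE => /andP[].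
    have deg4 : deg (S :\ c :\ u) u <= 4.
      have h := le_trans (deg_split_total u cN) (deg_le5 uc ud).
      rewrite -(lerD2r (m u c)); apply: le_trans h _.
      by have := m_ge1 mcu; rewrite m_sym; lra.
    have G_gt0 : 0 < f (S :\ c :\ u).
      by have [] := @sparse_ratio (S :\ c :\ u); rewrite /sparse ?inE ?eqxx ?andbF.
    by move: (deg _ _) (f _) (f _) deg4 G_gt0 => dd p q; nra.
  apply: ler_wpM2r; first by rewrite divr_ge0// ltW.
  have := deg_le_total (S :\ c) c; rewrite /deg (bigD1 d)//= => h.
  by rewrite -(lerD2l (m c d)); apply: le_trans (le_trans h deg_c) _; lra.
(* The two bounds add up to [(7 / 2 - m c d / 10) * f (S :\ c)], which is below [4 * f (S :\ c)]. *)
have := lerD d_term u_terms; move: (\sum_(u in _ | _) _) (m c d * f _) => p q h.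
apply: le_lt_trans h _.
have := m_cd; move: F_gt0; move: (m c d) (f _) => mm F; nra.
Qed.

End MatchingPositivity.

(** * Signings with prescribed signs *)

Section ChoiceSumSignings.
Variables (R : rcfType) (n : nat) (E : finType) (w : E -> R) (r : E -> bool -> 'cV[R]_n).

Definition edge_choices (es : seq E) := [seq (w e, (r e true, r e false)) | e <- es].

Definition rank1_sum (s : {ffun E -> bool}) (es : seq E) : 'M[R]_n :=
  \sum_(e <- es) w e *: (r e (s e) *m (r e (s e))^T).

Lemma rank1_sum_eq (s s' : {ffun E -> bool}) (es : seq E) : {in es, s =1 s'} -> rank1_sum s es = rank1_sum s' es.
Proof. by move=> ss'; apply: eq_big_seq => e /ss'->. Qed.

(** Each sequence of choices along [es] comes from [2 ^ (#|E| - size es)] signings; the powers are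
    placed so as to avoid the subtraction. *)
Lemma choice_sum_signings es M : uniq es ->
  2 ^+ #|E| * choice_sum (edge_choices es) M =
  2 ^+ size es * \sum_(s : {ffun E -> bool}) \det (M - rank1_sum s es).
Proof.
elim: es M => [|e es IHes] M /=.
  move=> _; rewrite expr0 mul1r /rank1_sum; under eq_bigr do rewrite big_nil subr0.
  by rewrite sumr_const card_ffun card_bool -[RHS]mulr_natl natrX.
move=> /andP[ees ues]; rewrite mulrDr !IHes// exprS -mulrDr (mulrC 2) -mulrA; congr (_ * _).
pose N (s : {ffun E -> bool}) := \det (M - rank1_sum s (e :: es)).
rewrite mulr2n mulrDl mul1r -/(N _).
rewrite [X in _ = _ + X](reindex_inj (inv_inj (flipK e))) -!big_split; apply: eq_bigr => s _ /=.
have fl : rank1_sum (flip e s) es = rank1_sum s es.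
  apply: rank1_sum_eq => f fes; rewrite ffunE; case: eqVneq => [fe|_]; last by rewrite addbF.
  by rewrite -fe fes in ees.
rewrite /N /rank1_sum !big_cons -/(rank1_sum s es) -/(rank1_sum (flip e s) es) fl ffunE eqxx addbT.
by case: (s e); rewrite !opprD !addrA//= addrC.
Qed.

Lemma apply_choice_signing es bs M : uniq es -> size bs = size es ->
  exists s : {ffun E -> bool}, apply_choice (edge_choices es) bs M = M - rank1_sum s es.
Proof.
elim: es bs M => [|e es IHes] [|b bs] M //=.
  by move=> _ _; exists [ffun=> true]; rewrite /rank1_sum big_nil subr0.
move=> /andP[ees ues] [sz]; set M' := (X in apply_choice _ _ X).
have [s ->] := IHes bs M' ues sz.
exists [ffun f => if f == e then b else s f].
rewrite /rank1_sum big_cons ffunE eqxx opprD addrA; congr (_ - _).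
  by rewrite /M'; case: (b).
apply: eq_big_seq => f fes; rewrite ffunE; case: eqVneq => // fe.
by rewrite -fe fes in ees.
Qed.

Lemma signing_selection M : M^T = M -> (forall e, 0 <= w e) ->
    (forall t, 0 <= t -> 0 < \sum_s \det (t%:M + M - rank1_sum s (enum E))) ->
  exists s, forall t, 0 <= t -> 0 < \det (t%:M + M - rank1_sum s (enum E)).
Proof.
move=> M_sym w_ge0 pos.
have [||bs sz bsP] := @choice_selection R n (edge_choices (enum E)) M M_sym.
- by apply/allP => _ /mapP[e _ ->]; exact: w_ge0.
- move=> t /pos; have := choice_sum_signings (t%:M + M) (enum_uniq E).
  by rewrite -cardE => /(mulfI _)->//; rewrite expf_neq0// pnatr_eq0.
- rewrite size_map in sz; have [s sP] := apply_choice_signing M (enum_uniq E) sz.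
  by exists s => t /bsP; rewrite sP addrA.
Qed.
End ChoiceSumSignings.

(** * Switching of signings *)

Section Gauge.
Variables (R : realFieldType) (n : nat) (E : finType) (a b : E -> 'I_n) (w : E -> R).
Hypothesis ab : forall e, a e != b e.
Local Notation char_mx := (char_mx a b w).

Definition switch (g : 'I_n -> bool) (s : {ffun E -> bool}) : {ffun E -> bool} :=
  [ffun e => s e (+) (g (a e) (+) g (b e))].

Lemma switchK g : involutive (switch g).
Proof. by move=> s; apply/ffunP => e; rewrite !ffunE -addbA addbb addbF. Qed.

Lemma joins_addb (g : 'I_n -> bool) e u v : joins a b e u v ->
  g (a e) (+) g (b e) = g u (+) g v.
Proof. by move=> /orP[]/andP[/eqP-> /eqP->]//; rewrite addbC. Qed.

(** Switching conjugates the matrix by a diagonal matrix of signs. *)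
Lemma det_switch g x s : \det (char_mx x (switch g s)) = \det (char_mx x s).
Proof.
pose G : 'M[R]_n := diag_mx (\row_i (-1) ^+ g i).
have GG : G *m G = 1%:M.
  rewrite mulmx_diag; apply/matrixP => i j; rewrite !mxE.
  by rewrite -expr2 sqrr_sign.
have -> : char_mx x (switch g s) = G *m char_mx x s *m G.
  rewrite mul_diag_mx mul_mx_diag; apply/matrixP => i j; rewrite [RHS]mxE [in RHS]mxE.
  rewrite [in RHS]mxE [X in _ = _ * X]mxE.
  have [->|ij] := eqVneq i j.
    by rewrite !char_mx_diag// mulrAC -expr2 sqrr_sign mul1r.
  rewrite !char_mx_off// mulrN mulNr mulr_sumr mulr_suml; congr (- _).
  apply: eq_bigr => e eij; rewrite /sgn ffunE (joins_addb g eij) !signr_addb; ring.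
by rewrite !det_mulmx mulrAC -det_mulmx GG det1 mul1r.
Qed.

Definition parity (s : {ffun E -> bool}) (p : seq (E * 'I_n)) :=
  \big[addb/false]_(q <- p) s q.1.

Lemma sgnw_parity s p : sgnw R s p = (-1) ^+ parity s p.
Proof. by rewrite /sgnw /parity; elim/big_rec2: _ => // q x y _ ->; rewrite signr_addb. Qed.

(** Along a path without repeated vertices any pattern of signs is the coboundary of a vertex
    function, built by adding up the signs from the start. *)
Lemma walk_potential (t : {ffun E -> bool}) (v : 'I_n) p z :
    walk a b v p -> uniq (v :: unzip2 p) ->
  exists g : 'I_n -> bool, [/\ g v = z, g (last v (unzip2 p)) = z (+) parity t p &
    forall e, e \in unzip1 p -> t e = g (a e) (+) g (b e)].
Proof.
elim: p v z => [|[e u] p IHp] v z /=.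
  by move=> _ _; exists (fun=> z); split=> //; rewrite /parity big_nil addbF.
move=> /andP[evu up] /andP[vup upU].
have [g [gu gl gp]] := IHp u (z (+) t e) up upU.
exists (fun y => if y == v then z else g y); split.
- by rewrite eqxx.
- have /negPf-> : last u (unzip2 p) != v.
    by apply: contraNneq vup => <-; exact: mem_last.
  by rewrite gl /parity big_cons addbA.
move=> f; rewrite inE => /predU1P[->|fp].
  rewrite [RHS](joins_addb (fun y => if y == v then z else g y) evu) eqxx.
  have /negPf-> : u != v by apply: contraNneq vup => ->; exact: mem_head.
  by rewrite gu addbA addbb.
rewrite gp//; have [fa fb] : a f != v /\ b f != v.
  suff : ~~ ((a f == v) || (b f == v)) by rewrite negb_or => /andP.
  apply/negP => fv; have : joins a b f v (if a f == v then b f else a f).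
    by rewrite /joins; case: eqP fv => [->|_]/= fv; rewrite ?eqxx// fv.
  by move=> /walk_notin/(_ up vup)/negP.
by rewrite (negPf fa) (negPf fb).
Qed.

End Gauge.

Section PrescribedCycle.
Variables (R : rcfType) (n : nat) (E : finType) (a b : E -> 'I_n) (w : E -> R).
Hypothesis ab : forall e, a e != b e.
Local Notation char_mx := (char_mx a b w).
Local Notation signing := {ffun E -> bool}.

Definition graft (D : seq E) (s0 s : signing) : signing :=
  [ffun e => if e \in D then s0 e else s e].

Variables (v y : 'I_n) (e f : E) (p : seq (E * 'I_n)).
Hypotheses (evy : joins a b e v y) (yp : walk a b y p).
Hypotheses (fzv : joins a b f (last y (unzip2 p)) v) (vypU : uniq (v :: y :: unzip2 p)).
Hypothesis ef : e != f.

Let D := e :: f :: unzip1 p.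
Let sgnD s : R := sgn R s e * sgnw R s p * sgn R s f.

Lemma sgnD_eq (s s' : signing) : {in D, s =1 s'} -> sgnD s = sgnD s'.
Proof.
move=> ss'; rewrite /sgnD /sgn !ss' ?inE ?eqxx ?orbT//; congr (_ * _ * _).
apply: eq_big_seq => q qp; rewrite /sgn ss'// !inE.
by rewrite (map_f _ qp : q.1 \in unzip1 p) !orbT.
Qed.

Lemma graft_sgnD s0 s : sgnD (graft D s0 s) = sgnD s0.
Proof. by apply: sgnD_eq => q qD; rewrite ffunE qD. Qed.

Lemma sgnD_parity s : sgnD s = (-1) ^+ (s e (+) parity s p (+) s f).
Proof. by rewrite /sgnD sgnw_parity /sgn -!signr_addb. Qed.

(** Two patterns on [D] with the same total sign differ by a switching: a potential along the path
    closes up on the last edge [f] exactly because the parities agree. Switching permutes the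
    signings and keeps determinants. *)
Lemma sum_graft_switch x (s0 s1 : signing) : sgnD s0 = sgnD s1 ->
  \sum_s \det (char_mx x (graft D s0 s)) = \sum_s \det (char_mx x (graft D s1 s)).
Proof.
rewrite !sgnD_parity => s01.
have par01 : s0 e (+) parity s0 p (+) s0 f = s1 e (+) parity s1 p (+) s1 f.
  by apply: (@can_inj _ _ (fun c : bool => (-1 : R) ^+ c) (fun r => r != 1)) => // -[];
    rewrite ?expr0 ?eqxx// expr1 eq_sym -subr_eq0 opprK -(natrD _ 1 1) pnatr_eq0.
pose t : signing := [ffun q => s0 q (+) s1 q].
have /andP[vyp ypU] := vypU.
have [|g [gv gl gp]] := @walk_potential n E a b t v ((e, y) :: p) false _ vypU.
  by rewrite /= evy.
have tE q : q \in D -> t q = g (a q) (+) g (b q).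
  rewrite !inE => /or3P[/eqP->|/eqP->|qp]; last 2 first.
  - rewrite (joins_addb g fzv) [last y _]/(last v (unzip2 ((e, y) :: p))) gl gv.
    rewrite addbF /= /parity big_cons /= !ffunE.
    have -> : \big[addb/false]_(q <- p) t q.1 = parity s0 p (+) parity s1 p.
      by rewrite /parity -big_split; apply: eq_bigr => r _; rewrite ffunE.
    by move: par01; case: (s0 e); case: (s1 e); case: (parity s0 p); case: (parity s1 p); case: (s0 f); case: (s1 f).
  - by apply: gp; rewrite /= inE qp orbT.
  - by apply: gp; rewrite /= inE eqxx.
rewrite (reindex_inj (inv_inj (switchK a b g))); apply: eq_bigr => s _.
rewrite -[in RHS](det_switch w ab g); congr (\det (char_mx x _)).
apply/ffunP => q; rewrite !ffunE; case: ifP => // qD.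
by have := tE q qD; rewrite ffunE => <-; rewrite [RHS]addbC addbK.
Qed.

(** The sum over all signings giving the cycle sign -1 is half the full sum minus half the sum
    weighted by the cycle sign, hence positive. All patterns of sign -1 on [D] contribute equally to
    it, so each contribution is positive. *)
Lemma graft_sum_gt0 x (s0 : signing) :
    (forall e, 0 <= w e) -> (forall S, 0 < minor_sum a b w x S) -> sgnD s0 = -1 ->
  0 < \sum_s \det (char_mx x (graft D s0 s)).
Proof.
move=> w_ge0 minor_gt0 s0D.
have neg_gt0 : 0 < \sum_(s | sgnD s == -1) \det (char_mx x s).
  have all_gt0 : 0 < \sum_s \det (char_mx x s).
    have := minor_gt0 setT; rewrite /minor_sum; congr (_ < _).
    apply: eq_bigr => s _; congr (\det _).
    by apply/matrixP => i j; rewrite !mxE !inE.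
  have := cycle_sum_le0 ab w_ge0 (fun S => ltW (minor_gt0 S)) evy yp fzv vypU ef.
  rewrite -/(sgnD _) => D_le0.
  have : \sum_s \det (char_mx x s) - \sum_s sgnD s * \det (char_mx x s) =
      2 * \sum_(s | sgnD s == -1) \det (char_mx x s).
    rewrite mulr_sumr [RHS]big_mkcond -sumrB; apply: eq_bigr => s _.
    rewrite sgnD_parity; case: (_ (+) _) => /=; first by rewrite expr1 eqxx; ring.
    by rewrite expr0 -subr_eq0 opprK -(natrD _ 1 1) pnatr_eq0 mul1r subrr.
  by move: D_le0; rewrite /sgnD; lra.
pose G (q : signing * signing) := \det (char_mx x (graft D q.1 q.2)).
(* Exchanging the values on [D] inside a pair of signings turns the double sum over grafted signings
   into a multiple of the sum over signings with cycle sign -1. *)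
have swapK : involutive (fun q : signing * signing => (graft D q.1 q.2, graft D q.2 q.1)).
  move=> [q r] /=; congr (_, _); apply/ffunP => t; rewrite !ffunE;
  by case: (t \in D).
have : 0 < \sum_(s1 | sgnD s1 == -1) \sum_s \det (char_mx x (graft D s1 s)).
  rewrite pair_big_dep/= (reindex_inj (inv_inj swapK))/=.
  rewrite (eq_bigl (fun q => (sgnD q.1 == -1) && true)) => [|q]; last by rewrite graft_sgnD andbT.
  rewrite (eq_bigr (fun q => \det (char_mx x q.1))) => [|q _]; last first.
    by congr (\det (char_mx x _)); apply/ffunP => t; rewrite !ffunE; case: (t \in D).
  rewrite -(pair_big_dep (fun q => sgnD q == -1) (fun _ _ => true) (fun q _ => \det (char_mx x q)))/=.
  under eq_bigr do rewrite sumr_const.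
  by rewrite sumrMnl pmulrn_lgt0// card_ffun card_bool expn_gt0.
rewrite (eq_bigr (fun=> \sum_s \det (char_mx x (graft D s0 s)))) => [|s1 /eqP s1D].
  rewrite sumr_const pmulrn_lgt0 //; apply/card_gt0P; exists s0.
  by rewrite unfold_in; apply/eqP.
by apply: sum_graft_switch; rewrite s0D.
Qed.
End PrescribedCycle.

Section IncidenceVectors.
Variables (R : rcfType) (n : nat) (E : finType) (a b : E -> 'I_n).
Hypothesis ab : forall e, a e != b e.

Definition incident e v := (a e == v) || (b e == v).

Definition incidence_vec e (c : bool) : 'cV[R]_n :=
  \col_i ((a e == i)%:R + (-1) ^+ c * (b e == i)%:R).

(** Each edge adds its weight to the diagonal at both ends and its signed weight off the diagonal.
    Constant weighted degree makes the diagonal scalar, so [- A_s] is a constant minus a sum of rank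
    one matrices. *)
Lemma rank1_sum_incidence (w : E -> R) k s :
    (forall v, \sum_(e | incident e v) w e = k) ->
  rank1_sum w incidence_vec s (enum E) = k%:M + signed_adj a b w s.
Proof.
move=> deg; rewrite /rank1_sum big_enum/=; apply/matrixP => i j; rewrite summxE !mxE.
have term e : (w e *: (incidence_vec e (s e) *m (incidence_vec e (s e))^T)) i j =
    (if incident e i then w e *+ (i == j) else 0) + sgn R s e * w e * (joins a b e i j)%:R.
  rewrite !mxE big_ord1 !mxE -/(sgn R s e) /joins /incident.
  have sg2 := sgn2 R s e; move: (sgn R s e) sg2 => g gg.
  have nab k0 : ~~ ((a e == k0) && (b e == k0)).
    by apply/negP => /andP[/eqP ae /eqP be]; have := ab e; rewrite ae be eqxx.
  have [->|ij] := eqVneq i j.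
    move: (nab j); case: (a e == j); case: (b e == j) => //= _; try ring.
    by rewrite !add0r mulr1 gg mulr1n; ring.
  have nij (k0 : 'I_n) : ~~ ((k0 == i) && (k0 == j)).
    by apply: contra ij => /andP[/eqP<-].
  rewrite mulr0n if_same add0r; move: (nab i) (nab j) (nij (a e)) (nij (b e)).
  by case: (a e == i); case: (a e == j); case: (b e == i); case: (b e == j) => //= *; ring.
under eq_bigr do rewrite term.
by rewrite big_split/= -big_mkcond/= sumrMnl deg.
Qed.

Lemma sum_mult (w : E -> R) v :
  \sum_u mult a b w v u = \sum_(e | incident e v) w e ^+ 2.
Proof.
rewrite /mult; under eq_bigr do rewrite big_mkcond; rewrite exchange_big [RHS]big_mkcond.
apply: eq_bigr => e _; rewrite -big_mkcond/=; case: ifP => [ev|nev]; last first.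
  rewrite big_pred0// => u; apply: contraFF nev.
  by rewrite /incident /joins => /orP[]/andP[? ?]; apply/orP; [left|right].
pose z := if a e == v then b e else a e.
rewrite (bigD1 z)/=; last first.
  by move: ev; rewrite /incident /joins /z; case: eqP => [->|_]/= bv; rewrite ?eqxx// bv.
rewrite big1 ?addr0// => u /andP[evu]; suff -> : u = z by rewrite eqxx.
move: evu; rewrite /joins /z => /orP[]/andP[/eqP ae /eqP be]; first by rewrite ae eqxx.
by case: eqP => [av|_//]; have := ab e; rewrite av be eqxx.
Qed.
End IncidenceVectors.

Section GoodSigning.
Variables (R : rcfType) (n : nat) (E : finType) (a b : E -> 'I_n).
Hypothesis ab : forall e, a e != b e.
Hypothesis reg : forall v, #|[pred e | incident a b e v]| = 5.
Variables (c d : E).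
Hypotheses (cd : c != d) (acd : a c = a d) (bcd : b c = b d).
Variables (v y : 'I_n) (e f : E) (p : seq (E * 'I_n)).
Hypotheses (evy : joins a b e v y) (yp : walk a b y p).
Hypotheses (fzv : joins a b f (last y (unzip2 p)) v) (vypU : uniq (v :: y :: unzip2 p)).
Hypothesis ef : e != f.

(* The parallel edges c and d, constrained to carry the same sign, act as a
   single edge of weight 2. *)
Let w (q : E) : R := 1 + (q == c)%:R - (q == d)%:R.

Let w_ge0 q : 0 <= w q.
Proof.
rewrite /w; have [->|_] := eqVneq q c; first by rewrite (negPf cd)/=; lra.
by case: (q == d) => /=; lra.
Qed.

Let w2 q : w q ^+ 2 = 1 + 3 * (q == c)%:R - (q == d)%:R.
Proof.
rewrite /w; have [->|_] := eqVneq q c; first by rewrite (negPf cd) /=; ring.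
by case: (q == d) => /=; ring.
Qed.

Let sum_indicator u q : \sum_(e | incident a b e u) (e == q)%:R = (incident a b q u)%:R :> R.
Proof.
rewrite big_mkcond (bigD1 q)//= eqxx big1 ?addr0 => [|t tq]; first by case: incident.
by rewrite (negPf tq) if_same.
Qed.

Let incident_cd u : incident a b c u = incident a b d u.
Proof. by rewrite /incident acd bcd. Qed.

Let deg_w u : \sum_(q | incident a b q u) w q = 5.
Proof.
rewrite /w sumrB big_split/= !sum_indicator incident_cd addrK.
by rewrite sumr_const reg.
Qed.

Let deg_w2 u : \sum_(q | incident a b q u) w q ^+ 2 = 5 + 2 * (incident a b c u)%:R.
Proof.
under eq_bigr do rewrite w2.
rewrite sumrB big_split/= -mulr_sumr !sum_indicator incident_cd sumr_const reg.
by ring.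
Qed.

(** Squared weights enter here: the merged edge counts 4, so its two ends have degree 7 and all
    other vertices degree 5. *)
Lemma heavy_minor_sum_gt0 x S : 4 <= x -> 0 < minor_sum a b w x S.
Proof.
move=> x_ge4.
apply: (@matching_positive R _ (mult a b w) _ x (a c) (b c)) => //.
- by move=> u t; exact: mult_sym.
- by move=> u; exact: multxx.
- by move=> u t; apply: sumr_ge0 => q _; exact: sqr_ge0.
- move=> u t; rewrite /mult; case: (pickP [pred q | joins a b q u t && (q != d)]) => [q /andP[qut qd] _|none].
    rewrite (bigD1 q)//= w2 (negPf qd) subr0 -[leLHS]addr0 lerD//.
      by rewrite lerDl mulr_ge0// ler0n.
    by apply: sumr_ge0 => r _; exact: sqr_ge0.
  rewrite big1 ?eqxx// => q qut; have /negbFE/eqP-> : (q != d) = false by move: (none q); rewrite /= qut.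
  by rewrite w2 eqxx [d == c]eq_sym (negPf cd)/=; ring.
- rewrite /mult (bigD1 c)/=; last by rewrite /joins !eqxx.
  rewrite w2 eqxx (negPf cd) -[leLHS]addr0 lerD//; first by rewrite /=; lra.
  by apply: sumr_ge0 => r _; exact: sqr_ge0.
- by rewrite sum_mult// deg_w2 /incident eqxx/=; lra.
- by rewrite sum_mult// deg_w2 /incident eqxx orbT/=; lra.
- move=> u ua ub; rewrite sum_mult// deg_w2 /incident eq_sym (negPf ua) eq_sym (negPf ub)/=; lra.
- rewrite /minor_sum (eq_bigr (fun=> 1)) => [|s _].
    by rewrite sumr_const pmulrn_lgt0// card_ffun card_bool expn_gt0.
  rewrite (_ : psub _ _ = 1%:M) ?det1//; apply/matrixP => i j; rewrite !mxE !inE.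
  by [].
- by move=> T u uT; exact: minor_sum_rec.
Qed.

Let D := e :: f :: unzip1 p.
Hypothesis dD : d \notin D.

Theorem good_signing : exists s : {ffun E -> bool},
  [/\ s c = s d, sgn R s e * sgnw R s p * sgn R s f = -1 &
      forall x, 4 <= x -> 0 < \det (char_mx a b (fun=> 1 : R) x s)].
Proof.
have /andP[vyp ypU] := vypU.
pose s0 : {ffun E -> bool} := [ffun q => q == e].
have s0D : sgn R s0 e * sgnw R s0 p * sgn R s0 f = -1.
  have e_p := walk_notin evy yp vyp.
  rewrite /sgn !ffunE eqxx eq_sym (negPf ef) mulr1 expr1.
  rewrite /sgnw big1_seq ?mulr1// => q /andP[_ qp]; rewrite /sgn ffunE.
  have -> : (q.1 == e) = false by apply: contraNF e_p => /eqP<-; apply: map_f.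
  by [].
(* On [D] both choices are the same vector; in this way the signs there are prescribed while the
   random matrix keeps its form. *)
pose r q (t : bool) := incidence_vec R a b q (if q \in D then s0 q else t).
have r_graft s : rank1_sum w r s (enum E) = 5%:M + signed_adj a b w (graft D s0 s).
  rewrite -(rank1_sum_incidence ab _ deg_w); apply: eq_bigr => q _.
  by rewrite /r !ffunE.
have char_graft t s : t%:M + 9%:M - rank1_sum w r s (enum E) = char_mx a b w (t + 4) (graft D s0 s).
  rewrite r_graft opprD addrA /char_mx; congr (_ - _).
  by rewrite -!raddfD/= -raddfB/=; congr (_%:M); ring.
(* In [9 = 5 + 4] the 5 cancels the diagonal of the rank one sum, and the 4 moves the ray from 4 on
   to the ray from 0 on. *)
have [|s sP] := @signing_selection R n E w r 9%:M (tr_scalar_mx _ _) w_ge0.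
  move=> t t_ge0; under eq_bigr do rewrite char_graft.
  apply: (graft_sum_gt0 ab evy yp fzv vypU ef w_ge0) => // S.
  by apply: heavy_minor_sum_gt0; lra.
pose s' := graft D s0 s.
(* [d] takes over the sign of [c]; as it lies off [D], the cycle sign is kept. *)
exists [ffun q => if q == d then s' c else s' q]; split.
- by rewrite !ffunE eqxx (negPf cd).
- rewrite -s0D -(graft_sgnD R e f p s0 s); apply: sgnD_eq => q qD.
  by rewrite [LHS]ffunE ifN//; apply: contraNneq dD => <-.
(* Weights 2 on [c] and 0 on [d] give the same matrix as weight 1 on both with equal signs. *)
move=> x x_ge4; have := sP (x - 4); rewrite char_graft subrK subr_ge0 => /(_ x_ge4).
congr (_ < \det (_ - _)); apply/matrixP => i j; rewrite !mxE.
have two (G : E -> R) : \sum_q G q = G c + G d + \sum_(q | (q != c) && (q != d)) G q.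
  by rewrite (bigD1 c)// (bigD1 d) 1?eq_sym//= addrA.
rewrite !two.
congr (_ + _).
  rewrite /sgn !ffunE eqxx (negPf cd) /w !eqxx (negPf cd) [d == c]eq_sym (negPf cd) /joins acd bcd /=.
  move: ((-1) ^+ _) ((-1) ^+ _) => g h.
  by rewrite -!mulrDl; congr (_ * _); ring.
apply: eq_bigr => q /andP[qc qd]; rewrite /w (negPf qc) (negPf qd) /sgn ffunE (negPf qd).
by rewrite addr0 subr0.
Qed.
End GoodSigning.

(** * Coloured graphs and the tree of reduced words *)

From mathcomp Require Import classical_sets functions cardinality fsbigop.

(* A set with k fixed-point-free involutions, one for each colour: the vertices of
   a k-regular graph with a proper edge colouring. *)
Record cspace (k : nat) := CSpace {
  cpoint : choiceType;
  cstep : 'I_k -> cpoint -> cpoint;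
  cstepK : forall c, involutive (cstep c);
  cstep_neq : forall c v, cstep c v <> v }.
Arguments cstep {k c} _ _ : rename.

Section ColouredGraph.
Local Open Scope classical_set_scope.
Variables (k : nat) (A : cspace k).

Definition cinv (e : cpoint A * 'I_k) := (cstep e.2 e.1, e.2).

Lemma cinvK : involutive cinv.
Proof. by move=> [v c]; rewrite /cinv/= cstepK. Qed.

Lemma cinv_neq e : cinv e <> e.
Proof. by case: e => v c [] /cstep_neq. Qed.

Definition cgraph : graph :=
  @Graph (cpoint A) (cpoint A * 'I_k)%type fst cinv cinvK cinv_neq.

Definition cwalk (w : seq 'I_k) (v : cpoint A) := foldl (fun v c => cstep c v) v w.

Lemma link_cgraph v : link (X := cgraph) v = [set (v, c) | c in [set: 'I_k]].
Proof.
apply/seteqP; split=> [[u c] /= <-|_ [c _ <-]//]; by exists c.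
Qed.

Lemma regular_cgraph : regular k cgraph.
Proof.
move=> v; rewrite link_cgraph.
have inj_link : {in [set: 'I_k] &, injective (fun c : 'I_k => (v, c) : edge cgraph)} by move=> c d _ _ [].
apply: card_eq_trans (inj_card_eq inj_link) _.
by apply: card_esym; exact: card_II.
Qed.

Lemma cwalk_connect v w : exists2 s, path (@adjacent cgraph) v s & last v s = cwalk w v.
Proof.
elim: w v => [|c w IHw] v; first by exists [::].
have [s sp sl] := IHw (cstep c v); exists (cstep c v :: s) => //=.
by rewrite sp andbT; apply/asboolP; exists ((v, c) : edge cgraph).
Qed.

Lemma cwalk_cat w1 w2 v : cwalk (w1 ++ w2) v = cwalk w2 (cwalk w1 v).
Proof. exact: foldl_cat. Qed.

Lemma cwalk_rev w v : cwalk (rev w) (cwalk w v) = v.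
Proof.
elim: w v => [//|c w IHw] v; rewrite rev_cons -cats1 cwalk_cat /= -[X in cstep c X]/(_).
by rewrite IHw cstepK.
Qed.

Lemma connected_cgraph v : (forall u, exists w, cwalk w v = u) -> connected_graph cgraph.
Proof.
move=> trans; split; first by exists v.
move=> x y; have [wx <-] := trans x; have [wy <-] := trans y.
have [s sp sl] := cwalk_connect (cwalk wx v) (rev wx ++ wy).
by exists s => //; rewrite sl cwalk_cat cwalk_rev.
Qed.

Lemma circuit_size (s : seq (edge cgraph)) : circuit s -> (2 <= size s)%N.
Proof.
case: s => [|[v c] [|//]] // /and4P[_ /=]; rewrite andbT => /eqP vc _ _.
by case: (@cstep_neq _ A c v).
Qed.

Lemma girth_digon (v : cpoint A) c d : c != d -> cstep c v = cstep d v -> has_girth cgraph 2.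
Proof.
move=> cd cdv; split; last exact: circuit_size.
exists [:: (v, c); (cstep c v, d)] => //; apply/and4P; split=> //=.
- rewrite /term /= eqxx cdv cstepK eqxx.
  by [].
- by rewrite inE andbT; apply/eqP => /esym; exact: cstep_neq.
- rewrite !inE !xpair_eqE /= (negPf cd) (eq_sym d c) (negPf cd) !andbF /= !eqxx !andbT orbF.
  by apply/andP; split; apply/eqP; exact: cstep_neq.
Qed.

Lemma adjacency_cgraph (R : realType) (f : cpoint A -> R[i]) v :
  adjacency (X := cgraph) f v = \sum_(c < k) f (cstep c v).
Proof.
rewrite /adjacency link_cgraph fsbig_image => [|c d _ _ []//].
have -> : [set: 'I_k] = [set` index_enum 'I_k].
  by apply/seteqP; split=> c //= _; exact: mem_index_enum.
by rewrite -fsbig_seq// index_enum_uniq.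
Qed.

End ColouredGraph.

Section FiniteColouredGraph.
Local Open Scope classical_set_scope.

Lemma finite_cgraph k (A : cspace k) : finite_set [set: cpoint A] -> finite_graph (cgraph A).
Proof.
move=> Afin; split=> //.
have -> : [set: edge (cgraph A)] = [set: cpoint A] `*` [set: 'I_k].
  by apply/seteqP; split=> -[].
by apply: finite_setX => //; exact: finite_finset.
Qed.

End FiniteColouredGraph.

Section ColouredMorphism.
Local Open Scope classical_set_scope.
Variables (k : nat) (A B : cspace k) (phi : cpoint A -> cpoint B).
Hypothesis phi_step : forall c v, phi (cstep c v) = cstep c (phi v).

Definition chom : graph_hom (cgraph A) (cgraph B) :=
  @Hom (cgraph A) (cgraph B) phi (fun e => (phi e.1, e.2)) (fun=> erefl)
    (fun e => congr1 (fun v => (v, e.2)) (phi_step e.2 e.1)).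

Lemma covering_chom : (forall u, exists v, phi v = u) -> covering chom.
Proof.
move=> phi_surj; split.
- by move=> u _; have [v <-] := phi_surj u; exists v.
- by move=> [u c] _; have [v <-] := phi_surj u; exists (v, c).
move=> v; split.
- by move=> [x c] xv; exact: (congr1 phi xv).
- move=> [x c] [y d] /set_mem xv /set_mem yv [_ ->].
  by rewrite [x](xv : x = v) [y](yv : y = v).
- move=> [x c] xv; exists (v, c); first by [].
  by congr (_, _); apply/esym; exact: xv.
Qed.

Lemma cwalk_morph w v : phi (cwalk w v) = cwalk w (phi v).
Proof. by elim: w v => //= c w IHw v; rewrite IHw phi_step. Qed.

End ColouredMorphism.

Section WordTree.
Local Open Scope classical_set_scope.
Local Open Scope quotient_scope.
Variable k : nat.

Definition reduced (w : seq 'I_k) := sorted (fun c d => c != d) w.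

Lemma reduced_rev w : reduced (rev w) = reduced w.
Proof. by rewrite /reduced rev_sorted; apply: eq_sorted => c d; rewrite eq_sym. Qed.

(** Left multiplication by the generator [c] in the free product of [k] groups of order 2. *)
Definition word_step (c : 'I_k) w :=
  if w is d :: w' then if d == c then w' else c :: w else [:: c].

Lemma word_step_reduced c w : reduced w -> reduced (word_step c w).
Proof.
case: w => [//|d w] dw /=; case: eqVneq => [_|dc].
  exact: path_sorted dw.
by rewrite /= eq_sym dc.
Qed.

Lemma word_stepK c w : reduced w -> word_step c (word_step c w) = w.
Proof.
case: w => [_|d w]/=; first by rewrite eqxx.
case: eqVneq => [->|dc] dw /=; last by rewrite eqxx.
by case: w dw => [//|d' w] /= /andP[cd' _]; rewrite eq_sym (negPf cd').
Qed.

Lemma size_word_step c w :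
  size (word_step c w) = if ohead w == Some c then (size w).-1 else (size w).+1.
Proof. by case: w => [//|d w] /=; rewrite (inj_eq Some_inj); case: eqP. Qed.

Definition word := {w : seq 'I_k | reduced w}.

Definition wstep c (w : word) : word := exist (fun w => is_true (reduced w)) _ (word_step_reduced c (valP w)).

Lemma wstepK c : involutive (wstep c).
Proof. by move=> w; apply: val_inj; rewrite /= word_stepK ?(valP w). Qed.

Lemma wstep_neq c w : wstep c w <> w.
Proof.
move=> /(congr1 (size \o val)); rewrite /= size_word_step.
case: w => -[|d w] dw //=; case: ifP => _ /eqP; last by rewrite gtn_eqF.
by rewrite ltn_eqF.
Qed.

Definition word_space : cspace k := CSpace wstepK wstep_neq.

Definition word_nil : word := exist (fun w => is_true (reduced w)) [::] isT.

Lemma word_cons c w (cw : reduced (c :: w)) (rw : reduced w) :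
  exist _ (c :: w) cw = wstep c (exist _ w rw) :> word.
Proof.
apply: val_inj => /=; case: w cw {rw} => [//|d w] /= /andP[cd _].
by rewrite eq_sym (negPf cd).
Qed.

Lemma word_ind (P : word -> Prop) : P word_nil -> (forall c w, P w -> P (wstep c w)) ->
  forall w, P w.
Proof.
move=> P0 PS [w rw]; elim: w rw => [|c w IHw] rw.
  by rewrite (_ : exist _ _ _ = word_nil)//; apply: val_inj.
by rewrite (word_cons rw (path_sorted rw)); apply: PS; exact: IHw.
Qed.

Lemma word_trans (u : word) : exists w, cwalk (A := word_space) w word_nil = u.
Proof.
elim/word_ind: u => [|c u [w <-]]; first by exists [::].
by exists (rcons w c); rewrite -cats1 cwalk_cat.
Qed.

(* At a vertex of maximal word length on a circuit, the two adjacent vertices are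
   both shorter, hence both equal to the unique shorter neighbour. *)
Lemma tree_word_space : tree (cgraph word_space).
Proof.
split; first by apply: (@connected_cgraph _ word_space word_nil); exact: word_trans.
move=> s; apply/negP => /and4P[s0 s_cyc _ /allP s_inv].
have [e0 e0s] : exists e0, e0 \in s by case: s s0 {s_cyc s_inv} => // e s _; exists e; exact: mem_head.
pose len (e : edge (cgraph word_space)) := size (val (orig e : word)).
pose B := \max_(e <- s) len e.
have len_le e : e \in s -> (len e <= B)%N by move=> es; exact: leq_bigmax_seq.
have [e es lenB] : exists2 e, e \in s & len e = B.
  have : has (fun e => len e == B) s.
    rewrite -[has _ _]negbK; apply/negP => /hasPn noB; have B_gt0 : (0 < B)%N.
      by rewrite lt0n; apply: contraNneq (noB _ e0s) => B0; have := len_le _ e0s; rewrite B0 leqn0.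
    suff : (B <= B.-1)%N by case: (B) B_gt0 => // b _; rewrite ltnn.
    apply/bigmax_leqP_seq => e es _; rewrite -ltnS prednK// ltn_neqAle noB//.
    exact: len_le.
  by move=> /hasP[e es /eqP lenB]; exists e.
pose e' := prev s e; have e's : e' \in s by rewrite mem_prev.
have /eqP e'e : term e' == orig e := prev_cycle s_cyc es.
have /eqP ee'' : term e == orig (next s e) := next_cycle s_cyc es.
have e''s : next s e \in s by rewrite mem_next.
pose v : word := e.1; pose c := e.2.
have eE : e = (v, c) by rewrite /v /c; case: (e).
have e'E : e' = einv ((v, e'.2) : edge (cgraph word_space)).
  by rewrite -[LHS]einvK; congr einv; rewrite /v -[e.1]/(orig e) -e'e; case: (e').
(* By maximality the step [d] must shorten the word, so [d] is its first letter. *)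
have short d (e1 : edge (cgraph word_space)) : e1 \in s -> orig e1 = wstep d v :> word -> ohead (val v) = Some d.
  move=> /len_le; rewrite /len => + e1E; rewrite e1E /= size_word_step.
  by case: ifP => [/eqP//|_]; rewrite -lenB /len /= ltnn.
have vc : ohead (val v) = Some c by apply: short e''s _; rewrite -ee'' eE.
have vd : ohead (val v) = Some e'.2 by apply: short e's _; rewrite e'E.
have cd : c = e'.2 by move: vd; rewrite vc => -[].
have := s_inv _ e's; rewrite {1}e'E einvK -cd -eE.
by rewrite es.
Qed.

Section Evaluation.
Variables (A : cspace k) (v : cpoint A).

(** Letters act from the right end, so that a change at the head by [wstep] becomes one further step
    in [A]. *)
Definition eval (w : word) : cpoint A := foldr (fun c u => cstep c u) v (val w).

Lemma eval_step c w : eval (wstep c w) = cstep c (eval w).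
Proof.
rewrite /eval /=; case: w => -[//|d w] /= _; case: eqP => [->|_] //=.
by rewrite cstepK.
Qed.

Lemma eval_cwalk w : eval w = cwalk (rev (val w)) v.
Proof. by rewrite /cwalk foldl_rev. Qed.

Definition eval_hom := chom (A := word_space) eval_step.

Lemma covering_eval : (forall u, exists w, cwalk w v = u) -> covering eval_hom.
Proof.
move=> trans; apply: covering_chom => u; have [w <-] := trans u.
exists (cwalk (A := word_space) w word_nil).
by rewrite (cwalk_morph (A := word_space) eval_step).
Qed.
End Evaluation.

(** A common deck transformation preserves colours, as the coverings do, and so commutes with all
    steps and is determined by the image of the empty word. That image is a word closed at every
    base point, hence empty; with trivial orbits the quotient map is invertible. *)
Lemma minimal_common_covering_word_space (A : nat -> cspace k) (v : forall n, cpoint (A n)) :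
    (forall w : word, (forall n, eval (v n) w = v n) -> w = word_nil) ->
  isomorphism (minimal_common_covering_map (fun n => eval_hom (v n))).
Proof.
move=> faithful; pose p n := eval_hom (v n).
have common_id h : common_deck_set p h -> vmap h =1 id /\ emap h =1 id.
  move=> h_deck.
  have hE e : emap h e = (vmap h e.1, e.2).
    have := hom_orig h e; have [_ [_ /(_ e)]] := h_deck 0%N I.
    by rewrite /=; case: (emap h e) => x d [_ ->] /= ->.
  have h_step c w : vmap h (wstep c w) = wstep c (vmap h w).
    have := hom_einv h ((w, c) : edge (cgraph word_space)).
    by rewrite !hE => -[].
  have h_id : vmap h =1 id.
    move=> w; elim/word_ind: w => [|c w IHw]; last by rewrite h_step IHw.
    by apply: faithful => n; have [_ [/(_ word_nil) + _]] := h_deck n I.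
  by split=> // -[w c]; rewrite hE h_id.
have v_inj x y : vorbit_of (common_deck p) x = vorbit_of (common_deck p) y -> x = y.
  by move=> /vorbitP[h /common_id[h_id _] <-]; rewrite h_id.
have e_inj x y : eorbit_of (common_deck p) x = eorbit_of (common_deck p) y -> x = y.
  by move=> /eorbitP[h /common_id[_ h_id] <-]; rewrite h_id.
pose vrepr (d : vorbit (common_deck p)) : word := @generic_quotient.repr _ {eq_quot vorbit_equiv_rel (common_deck p)} d.
have vreprK d : vorbit_of (common_deck p) (vrepr d) = d by exact: (@reprK _ {eq_quot vorbit_equiv_rel (common_deck p)}).
have inv_orig (e : edge (minimal_common_covering p)) : vrepr (orig e) = orig (erepr e) :> vertex (cgraph word_space).
  by apply: v_inj; rewrite vreprK.
have inv_einv (e : edge (minimal_common_covering p)) : erepr (einv e) = einv (erepr e).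
  by apply: e_inj; rewrite ereprK.
exists (@Hom (minimal_common_covering p) (cgraph word_space) vrepr (@erepr _ _) inv_orig inv_einv).
split; split=> x /=.
- by apply: v_inj; rewrite vreprK.
- by apply: e_inj; rewrite ereprK.
- exact: vreprK.
- exact: (@ereprK _ (common_deck p) x).
Qed.

End WordTree.

(** * Cycles in five-coloured bipartite graphs *)

Section CycleEdges.
Variables (n : nat) (E : finType) (a b : E -> 'I_n).
Hypothesis ab : forall e, a e != b e.

Lemma joins_pair e f u v y z : joins a b e u v -> joins a b e y z -> joins a b f u v ->
  joins a b f y z.
Proof.
move=> /orP[]/andP[/eqP<- /eqP<-] /orP[]/andP[/eqP<- /eqP<-] //; by rewrite joins_sym.
Qed.

Lemma walk_parallel v p e f u y : walk a b v p -> uniq (v :: unzip2 p) ->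
  e \in unzip1 p -> f \in unzip1 p -> joins a b e u y -> joins a b f u y -> e = f.
Proof.
elim: p v => [//|[g t] p IHp] v /= /andP[gvt tp] /andP[vtp tpU].
have absurd h : h \in unzip1 p -> joins a b h v t -> False.
  by move=> hp hvt; have := walk_notin hvt tp vtp; rewrite hp.
rewrite !inE => /predU1P[->|ep] /predU1P[->|fp] // ey fy.
- by case: (absurd f fp); apply: joins_pair ey gvt fy.
- by case: (absurd e ep); apply: joins_pair fy gvt ey.
- exact: IHp tp tpU ep fp ey fy.
Qed.

(** Two parallel edges of a simple cycle connect vertices that are adjacent along it in two ways,
    which happens only in length two. *)
Lemma cycle_parallel v y e f p e1 e2 u z :
    joins a b e v y -> walk a b y p -> joins a b f (last y (unzip2 p)) v ->
    uniq (v :: y :: unzip2 p) ->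
    e1 \in e :: f :: unzip1 p -> e2 \in e :: f :: unzip1 p -> e1 != e2 ->
    joins a b e1 u z -> joins a b e2 u z ->
  p = [::].
Proof.
move=> evy yp fzv vypU e1D e2D e12 e1u e2u.
have last_nil : last y (unzip2 p) = y -> p = [::].
  case: p vypU {yp fzv e1D e2D} => [//|[g t] p] /= /and3P[_ ytp _] last_y.
  by case/negP: ytp; rewrite -last_y; exact: mem_last.
have /andP[vyp _] := vypU.
have f_case h : h \in e :: unzip1 p -> joins a b h (last y (unzip2 p)) v -> p = [::].
  rewrite inE => /predU1P[->|hp] hzv; apply: last_nil.
    by apply: (joins_inj ab _ evy); rewrite joins_sym.
  by rewrite joins_sym in hzv; have := walk_notin hzv yp vyp; rewrite hp.
have D_cases h : h \in e :: f :: unzip1 p -> h = f \/ h \in e :: unzip1 p.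
  by rewrite !inE => /or3P[->|/eqP->|->]; [right|left|right; rewrite orbT].
case: (D_cases e1 e1D) => [e1f|e1P]; case: (D_cases e2 e2D) => [e2f|e2P].
- by rewrite e1f e2f eqxx in e12.
- by apply: (f_case e2 e2P); apply: joins_pair e1u _ e2u; rewrite e1f.
- by apply: (f_case e1 e1P); apply: joins_pair e2u _ e1u; rewrite e2f.
- suff e12' : e1 = e2 by rewrite e12' eqxx in e12.
  by apply: (@walk_parallel v ((e, y) :: p) e1 e2 u z) => //=; rewrite evy.
Qed.
End CycleEdges.

(* A 5-regular bipartite graph whose two sides are copies of [pt] and whose edges of
   colour c are the pairs (v, fw c v). *)
Record system := System {
  pt : finType;
  fw : 'I_5 -> pt -> pt;
  bw : 'I_5 -> pt -> pt;
  fwK : forall c, cancel (fw c) (bw c);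
  bwK : forall c, cancel (bw c) (fw c) }.
Arguments fw {s} _ _. Arguments bw {s} _ _.

Definition vtx (S : system) : finType := (bool * pt S)%type.

Section System.
Variable S : system.
Implicit Types (x y : vtx S) (c d : 'I_5) (e : pt S * 'I_5).

Definition sstep c x : vtx S := if x.1 then (false, bw c x.2) else (true, fw c x.2).

Lemma sstepK c : involutive (sstep c).
Proof. by move=> [[] v]; rewrite /sstep/= ?fwK ?bwK. Qed.

Lemma sstep_neq c x : sstep c x <> x.
Proof. by case: x => [[] v]. Qed.

Definition space : cspace 5 := @CSpace 5 (vtx S) sstep sstepK sstep_neq.

Definition edge_of x c : pt S * 'I_5 := (if x.1 then bw c x.2 else x.2, c).

Definition left_end e : 'I_#|vtx S| := enum_rank ((false, e.1) : vtx S).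
Definition right_end e : 'I_#|vtx S| := enum_rank ((true, fw e.2 e.1) : vtx S).

Lemma ends_neq e : left_end e != right_end e.
Proof. by rewrite (inj_eq enum_rank_inj). Qed.

Local Notation joins := (joins left_end right_end).

Lemma joins_edge e x y :
  joins e (enum_rank x) (enum_rank y) = (e == edge_of x e.2) && (y == sstep e.2 x).
Proof.
rewrite /joins !(inj_eq enum_rank_inj); case: e => v c; case: x => [[] u]; case: y => [[] t].
all: rewrite /edge_of /sstep /= !xpair_eqE /= ?eqxx ?andbF ?andbT ?orbF//=.
- rewrite (can2_eq (fwK c) (bwK c)) andbC; case: eqVneq => [->|//].
  by rewrite eq_sym.
- by case: eqVneq => [->|//]; rewrite eq_sym.
Qed.

Lemma incident_edge e x : incident left_end right_end e (enum_rank x) = (e == edge_of x e.2).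
Proof.
rewrite /incident !(inj_eq enum_rank_inj); case: e => v c; case: x => [[] u].
  by rewrite /edge_of /= !xpair_eqE /= eqxx andbT (can2_eq (fwK c) (bwK c)).
by rewrite /edge_of /= !xpair_eqE /= eqxx !andbT orbF.
Qed.

Lemma big_edges (T : nmodType) (F : pt S * 'I_5 -> T) x :
  \sum_(e | e == edge_of x e.2) F e = \sum_c F (edge_of x c).
Proof.
rewrite (reindex_onto (edge_of x) snd) => [|e /eqP <-//].
by apply: eq_bigl => c; rewrite /= !eqxx.
Qed.

Lemma card_incident v : #|[pred e | incident left_end right_end e v]| = 5%N.
Proof.
rewrite -sum1_card -(enum_valK v).
rewrite (eq_bigl (fun e => e == edge_of (enum_val v) e.2)) => [|e]; last by rewrite inE incident_edge.
by rewrite (big_edges (fun=> 1%N)) sum_nat_const card_ord.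
Qed.

Local Notation act := (cwalk (A := space)).

Definition visits x w := scanl (fun y c => sstep c y) x w.

Fixpoint steps x w : seq ((pt S * 'I_5) * 'I_#|vtx S|) :=
  if w is c :: w' then (edge_of x c, enum_rank (sstep c x)) :: steps (sstep c x) w' else [::].

Lemma walk_steps x w : walk left_end right_end (enum_rank x) (steps x w).
Proof. by elim: w x => //= c w IHw x; rewrite IHw joins_edge/= !eqxx. Qed.

Lemma steps_visits x w : unzip2 (steps x w) = [seq enum_rank y | y <- visits x w].
Proof. by elim: w x => //= c w IHw x; rewrite IHw. Qed.

Lemma last_visits x w : last x (visits x w) = act w x.
Proof. by elim: w x => //= c w IHw x. Qed.

Lemma visits_cat x w1 w2 :
  visits x (w1 ++ w2) = visits x w1 ++ visits (act w1 x) w2.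
Proof. by elim: w1 x => //= c w1 IHw x; rewrite IHw. Qed.

(** Separating [c1] and [ck] forces at least two edges. The last clause excludes going back along
    the first edge, which is possible only if [m] is empty. *)
Record simple_cycle x c1 m ck : Prop := SimpleCycle {
  sc_uniq : uniq (x :: visits x (c1 :: m));
  sc_closed : sstep ck (act (c1 :: m) x) = x;
  sc_edges : edge_of x c1 != edge_of (act (c1 :: m) x) ck }.

Lemma visited_prefix x w y : y \in x :: visits x w ->
  exists w1 w2, w = w1 ++ w2 /\ act w1 x = y.
Proof.
elim: w x => [|c w IHw] x.
  by rewrite inE => /eqP->; exists [::], [::].
rewrite /= inE => /predU1P[->|/IHw[w1 [w2 [-> <-]]]]; first by exists [::], (c :: w).
by exists (c :: w1), w2.
Qed.

(** The shortest prefix that revisits a vertex ends in a closed walk with otherwise distinct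
    vertices. *)
Lemma reduced_cycle x w : reduced w -> ~~ uniq (x :: visits x w) ->
  exists w1 c1 m ck w2, w = w1 ++ (c1 :: rcons m ck) ++ w2 /\
    simple_cycle (act w1 x) c1 m ck.
Proof.
elim/last_ind: w => [//|w c IHw] wc_red.
have w_red : reduced w.
  by move: wc_red; rewrite -reduced_rev rev_rcons => /path_sorted; rewrite -/(reduced _) reduced_rev.
have [xw_uniq|/(IHw w_red)] := boolP (uniq (x :: visits x w)); last first.
  move=> [w1 [c1 [m [ck [w2 [-> cyc]]]]]] _; exists w1, c1, m, ck, (rcons w2 c).
  by split=> //; rewrite -!rcons_cat.
have -> : visits x (rcons w c) = rcons (visits x w) (sstep c (act w x)).
  by rewrite -cats1 visits_cat /= cats1.
rewrite -rcons_cons rcons_uniq xw_uniq andbT negbK.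
set z := act w x; set u := sstep c z => u_visited.
have [w1 [w3 [w_cat w1u]]] := visited_prefix u_visited.
have [c1 [m w3E]] : exists c1 m, w3 = c1 :: m.
  case: w3 w_cat => [|c1 m _]; last by exists c1, m.
  by rewrite cats0 => ww1; move: w1u; rewrite -ww1 => /esym/sstep_neq.
exists w1, c1, m, c, [::]; split; first by rewrite cats0 w_cat w3E -cats1 -catA -rcons_cons -cats1.
have zE : act (c1 :: m) u = z by rewrite /z w_cat w3E cwalk_cat w1u.
have uniq_u : uniq (u :: visits u (c1 :: m)).
  move: xw_uniq; rewrite w_cat w3E visits_cat w1u -cat_cons lastI cat_rcons.
  by rewrite -[last _ _]/(last x (visits x w1)) last_visits w1u cat_uniq => /and3P[].
rewrite w1u; split=> //; first by rewrite zE.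
(* If the first and last edges agreed, so would their colours; then [m] is empty and the word
   contains a letter twice in a row. *)
apply/eqP => /(congr1 snd) /= c1c.
have m0 : m = [::].
  have uz : sstep c1 u = z by rewrite c1c /u sstepK.
  case: m uniq_u zE {w3E} => [//|d m] /= /and3P[_ /negP nz _] zE; case: nz.
  have : act (d :: m) (sstep c1 u) \in visits (sstep c1 u) (d :: m).
    by rewrite -last_visits; exact: (mem_last (sstep d (sstep c1 u)) (visits (sstep d (sstep c1 u)) m)).
  by rewrite (zE : act (d :: m) (sstep c1 u) = z) -{1}uz.
move: wc_red; rewrite w_cat w3E m0 c1c -cats1 -catA /=.
by rewrite -reduced_rev rev_cat /= => /= ; rewrite eqxx.
Qed.

Definition digon (v : pt S) c d := c != d /\ fw c v = fw d v.

End System.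

(** * Two-lifts *)

Section Lift.
Variables (S : system) (s : {ffun (pt S * 'I_5) -> bool}).
Local Notation act := (cwalk (A := space _)).

Definition lift_fw c (v : pt S * bool) := (fw c v.1, v.2 (+) s (v.1, c)).
Definition lift_bw c (v : pt S * bool) := (bw c v.1, v.2 (+) s (bw c v.1, c)).

Lemma lift_fwK c : cancel (lift_fw c) (lift_bw c).
Proof. by move=> [v t]; rewrite /lift_bw /= fwK -addbA addbb addbF. Qed.

Lemma lift_bwK c : cancel (lift_bw c) (lift_fw c).
Proof. by move=> [v t]; rewrite /lift_fw /= bwK -addbA addbb addbF. Qed.

Definition two_lift : system :=
  @System (pt S * bool)%type lift_fw lift_bw lift_fwK lift_bwK.

Definition over (x : vtx S) (t : bool) : vtx two_lift := (x.1, (x.2, t)).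
Definition proj (y : vtx two_lift) : vtx S := (y.1, y.2.1).

Lemma over_proj (y : vtx two_lift) : over (proj y) y.2.2 = y.
Proof. by case: y => r [v t]. Qed.

Lemma proj_over x t : proj (over x t) = x.
Proof. by case: x. Qed.

Lemma step_over c x t : sstep c (over x t) = over (sstep c x) (t (+) s (edge_of x c)).
Proof. by case: x => [[] v]. Qed.

Lemma proj_step c y : proj (sstep c y) = sstep c (proj y).
Proof. by case: y => [[] [v t]]. Qed.

Fixpoint path_sign (x : vtx S) (w : seq 'I_5) : bool :=
  if w is c :: w' then s (edge_of x c) (+) path_sign (sstep c x) w' else false.

Lemma path_sign_cat x w1 w2 :
  path_sign x (w1 ++ w2) = path_sign x w1 (+) path_sign (act w1 x) w2.
Proof. by elim: w1 x => //= c w1 IHw x; rewrite IHw addbA. Qed.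

Lemma act_over w x t : act w (over x t) = over (act w x) (t (+) path_sign x w).
Proof.
elim: w x t => [|c w IHw] x t /=; first by rewrite addbF.
by rewrite step_over IHw addbA.
Qed.

Lemma path_sign_rev w x : path_sign (act w x) (rev w) = path_sign x w.
Proof.
have := cwalk_rev (A := space two_lift) w (over x false).
rewrite !act_over addFb => /(congr1 (fun y : vtx two_lift => y.2.2)) /=.
by case: path_sign; case: path_sign.
Qed.

Lemma path_sign_steps (R : realFieldType) x w :
  sgnw R s (steps x w) = (-1) ^+ path_sign x w.
Proof.
elim: w x => [|c w IHw] x /=; first by rewrite /sgnw big_nil.
by rewrite /sgnw big_cons -/(sgnw R s _) IHw signr_addb.
Qed.

(** Going to [z], round the negative loop and back leads from [x] to the other sheet, so the lift
    stays connected. *)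
Lemma lift_transitive x c1 m ck : (forall y, exists w, act w x = y) ->
    forall z, act (c1 :: rcons m ck) z = z -> path_sign z (c1 :: rcons m ck) ->
  forall t y, exists w, act w (over x t) = y.
Proof.
move=> trans z; set l := c1 :: _ => lz sl t y.
have [w0 w0x] := trans z; have [w wx] := trans (proj y).
pose loop := w0 ++ l ++ rev w0.
have loopx : act loop x = x by rewrite /loop !cwalk_cat w0x lz -w0x cwalk_rev.
have loop_sign : path_sign x loop.
  by rewrite /loop !path_sign_cat w0x lz -{2}w0x path_sign_rev sl addbC addbK.
have [same|diff] := eqVneq (t (+) path_sign x w) y.2.2.
  by exists w; rewrite act_over wx same over_proj.
exists (loop ++ w); rewrite act_over path_sign_cat cwalk_cat loopx wx loop_sign.
have -> : t (+) (true (+) path_sign x w) = y.2.2.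
  by move: diff; case: t; case: path_sign; case: y.2.2.
exact: over_proj.
Qed.

Lemma lift_digon v c d t : digon v c d -> s (v, c) = s (v, d) -> digon (S := two_lift) (v, t) c d.
Proof. by move=> [cd vcd] scd; split=> //; rewrite /= /lift_fw /= vcd scd. Qed.

(** The quantity that measures progress: it never drops under lifting and is at most the length of
    the word plus one. *)
Definition trail_size (T : system) (x : vtx T) w := size (undup (x :: visits x w)).

Lemma map_proj_visits y w : [seq proj u | u <- visits y w] = visits (proj y) w.
Proof.
elim: w y => //= c w IHw y; rewrite -!/(visits _ _) IHw proj_step.
by [].
Qed.

Lemma visits_over x t w :
  x :: visits x w = [seq proj u | u <- over x t :: visits (over x t) w].
Proof. by rewrite /= map_proj_visits proj_over. Qed.

Lemma trail_size_lift x t w : (trail_size x w <= trail_size (over x t) w)%N.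
Proof.
rewrite /trail_size (visits_over x t).
apply: leq_trans (_ : size [seq proj u | u <- undup (over x t :: visits (over x t) w)] <= _)%N; last by rewrite size_map.
rewrite uniq_leq_size ?undup_uniq// => u; rewrite mem_undup => /mapP[y yv ->].
by apply: map_f; rewrite mem_undup.
Qed.

(** The lift of the negative loop [l] is no longer closed: its ends [y1] and [y2] are distinct but
    lie over one vertex. Hence the lifted trail without [y2] still projects onto the whole trail
    below. *)
Lemma trail_size_lift_lt x t w1 l w2 :
    act l (act w1 x) = act w1 x -> path_sign (act w1 x) l ->
  (trail_size x (w1 ++ l ++ w2) < trail_size (over x t) (w1 ++ l ++ w2))%N.
Proof.
move=> lz sl; set w := w1 ++ _; rewrite ltn_neqAle trail_size_lift andbT.
apply/negP => /eqP same.
pose V := undup (over x t :: visits (over x t) w).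
have visit_mem u1 u2 : w = u1 ++ u2 -> act u1 (over x t) \in V.
  move=> wE; rewrite /V mem_undup wE visits_cat -cat_cons mem_cat -last_visits.
  by apply/orP; left; exact: mem_last.
pose y1 := act w1 (over x t); pose y2 := act (w1 ++ l) (over x t).
have y1V : y1 \in V by apply: (visit_mem _ (l ++ w2)).
have y2V : y2 \in V by apply: (visit_mem _ w2); rewrite /w catA.
have y21 : y2 = over (act w1 x) (~~ (t (+) path_sign x w1)).
  by rewrite /y2 act_over path_sign_cat cwalk_cat lz sl addbT addbN.
have y1E : y1 = over (act w1 x) (t (+) path_sign x w1) by exact: act_over.
have y12 : y1 != y2.
  by rewrite y21 y1E; apply/eqP => /(congr1 (fun y : vtx two_lift => y.2.2)) /=; case: (_ (+) _).
suff : (trail_size x w <= size (rem y2 V))%N.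
  rewrite same size_rem// -/(size V) /trail_size -/V leqNgt ltn_predL.
  by case: (V) y1V.
rewrite /trail_size -(size_map proj) uniq_leq_size ?undup_uniq// => u.
rewrite mem_undup (visits_over x t) => /mapP[y].
rewrite -mem_undup -/V => yV ->; have [->|yy2] := eqVneq y y2.
  have -> : proj y2 = proj y1 by rewrite y21 y1E !proj_over.
  by apply: map_f; rewrite mem_rem_uniq ?undup_uniq//; apply/andP; split.
by apply: map_f; rewrite mem_rem_uniq ?undup_uniq//; apply/andP; split.
Qed.
End Lift.

(** * Eigenvalues of two-lifts *)

Section Spectrum.
Variable R : rcfType.
Local Notation C := R[i].
Local Notation Re := (@complex.Re R).
Local Notation Im := (@complex.Im R).
Local Notation toC := (map_mx (real_complex R)).

(** If [Im t > 0], then [t - M] has positive form and so no kernel. Applied to [u] and to its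
    conjugate, this makes the eigenvalue real. *)
Lemma symmetric_eigenvalue n (M : 'M[R]_n) (u : 'cV[C]_n) (z : C) : M^T = M -> u != 0 ->
  toC M *m u = z *: u -> exists2 r : R, z = r%:C%C & \det (r%:M - M) = 0.
Proof.
move=> M_sym u0 Mu.
have kernel_det (N : 'M[C]_n) (y : 'cV_n) : y != 0 -> N *m y = 0 -> \det N = 0.
  move=> y0 Ny; apply/eqP; rewrite -det_tr; apply/det0P; exists y^T.
    by rewrite trmx_eq0.
  by rewrite -trmx_mul Ny trmx0.
have im_le0 (y : 'cV_n) (t : C) : y != 0 -> toC M *m y = t *: y -> Im t <= 0.
  move=> y0 My; rewrite leNgt; apply/negP => t_gt0.
  have NM_sym : (- M)^T = - M by rewrite -[in RHS]M_sym; apply/matrixP => i j; rewrite !mxE.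
  have := im_form_pos_det (im_form_pos_shift NM_sym t_gt0).
  rewrite (kernel_det _ y y0) ?eqxx// mulmxDl mul_scalar_mx map_mxN mulNmx My.
  by rewrite subrr.
have z_real : Im z = 0.
  apply/eqP; rewrite eq_le (im_le0 u)//=.
  have conj_u0 : map_mx (@conjc R) u != 0.
    apply: contraNneq u0 => u'0; apply/eqP/colP => i; rewrite mxE.
    by have := congr1 (fun y : 'cV_n => y i 0) u'0; rewrite !mxE => /eqP; rewrite conjc_eq0 => /eqP.
  have := im_le0 _ (z^*)%C conj_u0.
  suff -> : toC M *m map_mx (@conjc R) u = (z^*)%C *: map_mx (@conjc R) u.
    by move=> /(_ erefl); case: (z) => p q /=; rewrite oppr_le0.
  have -> : toC M = map_mx (@conjc R) (toC M).
    by apply/matrixP => i j; rewrite !mxE /= oppr0.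
  by rewrite -map_mxM Mu map_mxZ.
exists (Re z); first by case: (z) z_real => p q /= ->.
apply: (@complexI R); rewrite -det_map_mx map_mxB map_scalar_mx /= rmorph0.
apply: (kernel_det _ u u0); rewrite mulmxBl mul_scalar_mx Mu.
by rewrite (_ : (Re z)%:C%C = z) ?subrr//; case: (z) z_real => p q /= ->.
Qed.

Variable S : system.
Local Notation n := #|vtx S|.
Local Notation adj s := (signed_adj (@left_end S) (@right_end S) (fun=> 1 : R) s).

Lemma signed_adj_mul (s : {ffun pt S * 'I_5 -> bool}) (g : vtx S -> C) (x : vtx S) :
  (toC (adj s) *m \col_i g (enum_val i)) (enum_rank x) 0 =
  \sum_c (sgn R s (edge_of x c))%:C%C * g (sstep c x).
Proof.
rewrite mxE; transitivity (\sum_j \sum_(e | joins (@left_end S) (@right_end S) e (enum_rank x) j)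
    (sgn R s e)%:C%C * g (enum_val j)).
  apply: eq_bigr => j _; rewrite !mxE rmorph_sum mulr_suml [RHS]big_mkcond.
  apply: eq_bigr => e _; rewrite mulr1 rmorphM/=; case: ifP => _.
    by rewrite rmorph1 mulr1.
  by rewrite rmorph0 mulr0 mul0r.
rewrite (reindex_onto (@enum_rank (vtx S)) enum_val) => [|j _]; last exact: enum_valK.
rewrite (eq_bigl xpredT) => [|y]; last by rewrite enum_rankK eqxx.
under eq_bigr => y _ do under eq_bigl => e do rewrite joins_edge.
under eq_bigr => y _ do rewrite enum_rankK big_mkcondr.
rewrite exchange_big/= -(big_edges (fun e => (sgn R s e)%:C%C * g (sstep e.2 x))).
apply: eq_bigr => e _.
by rewrite -big_mkcond/= big_pred1_eq.
Qed.

(** Positivity of the determinant from 4 on bounds eigenvalues from above only. As the graph is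
    bipartite, changing the sign of [g] on one side gives an eigenfunction for [- z], hence the
    bound from below. *)
Lemma signed_eigenvalue (s : {ffun pt S * 'I_5 -> bool}) (g : vtx S -> C) (z : C) :
    (forall x : R, 4 <= x -> 0 < \det (char_mx (@left_end S) (@right_end S) (fun=> 1 : R) x s)) ->
    (exists v, g v != 0) ->
    (forall x, \sum_c (sgn R s (edge_of x c))%:C%C * g (sstep c x) = z * g x) ->
  `|z| <= 4.
Proof.
move=> det_gt0 [v gv] gz.
have upper (h : vtx S -> C) (t : C) : h v != 0 ->
    (forall x, \sum_c (sgn R s (edge_of x c))%:C%C * h (sstep c x) = t * h x) ->
    exists2 r : R, t = r%:C%C & r <= 4.
  move=> hv ht; pose u : 'cV[C]_n := \col_i h (enum_val i).
  have u0 : u != 0.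
    by apply: contraNneq hv => /colP/(_ (enum_rank v)); rewrite !mxE enum_rankK => ->.
  have [|r -> det0] := @symmetric_eigenvalue _ (adj s) u t (signed_adj_tr _ _ _ s) u0.
    apply/colP => i; rewrite -(enum_valK i) signed_adj_mul ht !mxE enum_rankK.
    by [].
  exists r => //; rewrite leNgt; apply/negP => /ltW/det_gt0.
  by rewrite /char_mx det0 ltxx.
have [r zr r4] := upper g z gv gz.
have [|x|t zt t4] := upper (fun x => if x.1 then g x else - g x) (- z).
- by case: ifP; rewrite ?oppr_eq0.
- have -> : - z * (if x.1 then g x else - g x) = (if x.1 then - 1 else 1) * (z * g x).
    by case: x.1; ring.
  rewrite -gz mulr_sumr; apply: eq_bigr => c _.
  by case: x => [[] y] /=; ring.
rewrite zr in zt *; have tr : t = - r by move: zt => /(congr1 Re) /= ->.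
rewrite normc_def /= expr0n addr0 sqrtr_sqr.
have -> : (4 : C) = (4 : R)%:C%C by rewrite rmorph_nat.
by rewrite lecR ler_norml r4 andbT; move: t4; rewrite tr; lra.
Qed.

Definition spectrum_le4 (T : system) := forall (z : C) (g : vtx T -> C),
  (exists v, g v != 0) -> (forall x, \sum_c g (sstep c x) = z * g x) ->
  z != 5%:R -> z != - 5%:R -> `|z| <= 4.

(** The part of [g] even on fibres is a function on the base with eigenvalue [z]; if it vanishes,
    the odd part is a nonzero eigenfunction of the signed adjacency matrix. *)
Lemma spectrum_lift (s : {ffun pt S * 'I_5 -> bool}) :
    (forall x : R, 4 <= x -> 0 < \det (char_mx (@left_end S) (@right_end S) (fun=> 1 : R) x s)) ->
  spectrum_le4 S -> spectrum_le4 (two_lift s).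
Proof.
move=> det_gt0 specS z g [y gy] gz z5 zN5.
have gz_over x t : \sum_c g (over s (sstep c x) (t (+) s (edge_of x c))) = z * g (over s x t).
  by rewrite -gz; apply: eq_bigr => c _; rewrite step_over.
pose gp x := g (over s x false) + g (over s x true).
pose gm x := g (over s x false) - g (over s x true).
have [[v gpv]|/forallNP gp0] := pselect (exists v, gp v != 0).
  apply: (specS z gp) => //; first by exists v.
  move=> x; rewrite mulrDr -!gz_over -big_split; apply: eq_bigr => c _.
  by rewrite /gp; case: (s _) => //=; rewrite addrC.
apply: (@signed_eigenvalue s gm z det_gt0).
  apply/not_existsP => gm0; move/negP: gy; apply; rewrite -(over_proj y).
  have {}gp0 := gp0 (proj y); have {}gm0 := gm0 (proj y).
  move/negP: gp0; rewrite negbK => /eqP gp0; move/negP: gm0; rewrite negbK => /eqP gm0.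
  have g2 : 2 * g (over s (proj y) false) = 0.
    by rewrite -[RHS](addr0 0) -{1}gp0 -gm0 /gp /gm; ring.
  have gf : g (over s (proj y) false) = 0.
    by apply/eqP; move/eqP: g2; rewrite mulf_eq0 pnatr_eq0.
  by case: (y.2.2); rewrite ?gf//; move: gp0; rewrite /gp gf add0r => ->.
move=> x; rewrite mulrBr -!gz_over -sumrB; apply: eq_bigr => c _.
by rewrite /sgn /gm; case: (s _) => /=; rewrite ?expr1 ?expr0 ?rmorphN rmorph1; ring.
Qed.
End Spectrum.

(** * The tower *)

Section Tower.
Variable R : realType.
Local Notation act := (cwalk (A := space _)).

(* Two edge-disjoint digons, so that at least one of them differs from the cycle to
   be destroyed at the next stage. *)
Record admissible (S : system) (x : vtx S) : Prop := Admissible {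
  adm_transitive : forall y, exists w, act w x = y;
  adm_spectrum : spectrum_le4 R S;
  adm_digons : exists v c d v' c' d', [/\ digon (S := S) v c d, digon (S := S) v' c' d' &
    forall e, e \in [:: (v, c); (v, d)] -> e \notin [:: (v', c'); (v', d')]] }.

Lemma digon_cycle (S : system) v c d : digon (S := S) v c d ->
  simple_cycle (S := S) (false, v) c [::] d.
Proof.
move=> [cd vcd]; split=> //.
- by rewrite /sstep /= vcd fwK.
- by rewrite /edge_of /= xpair_eqE vcd fwK eqxx.
Qed.

Definition cycle_edges (S : system) (z : vtx S) c1 m ck :=
  edge_of z c1 :: edge_of (act (c1 :: m) z) ck :: unzip1 (steps (sstep c1 z) m).

Lemma last_steps (S : system) (z : vtx S) m :
  last (enum_rank z) (unzip2 (steps z m)) = enum_rank (act m z).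
Proof. by rewrite steps_visits last_map last_visits. Qed.

Section Cycle.
Variables (S : system) (z : vtx S) (c1 : 'I_5) (m : seq 'I_5) (ck : 'I_5).
Hypothesis cyc : simple_cycle z c1 m ck.
Local Notation lend := (@left_end S).
Local Notation rend := (@right_end S).

Lemma cycle_first : joins lend rend (edge_of z c1) (enum_rank z) (enum_rank (sstep c1 z)).
Proof. by rewrite joins_edge/= !eqxx. Qed.

Lemma cycle_last : joins lend rend (edge_of (act (c1 :: m) z) ck)
  (last (enum_rank (sstep c1 z)) (unzip2 (steps (sstep c1 z) m))) (enum_rank z).
Proof. by rewrite last_steps joins_edge/= eqxx -{1}(sc_closed cyc) /=. Qed.

Lemma cycle_uniq : uniq (enum_rank z :: enum_rank (sstep c1 z) :: unzip2 (steps (sstep c1 z) m)).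
Proof.
rewrite steps_visits -!map_cons map_inj_uniq; first exact: sc_uniq cyc.
exact: enum_rank_inj.
Qed.

(** If the cycle contains both edges of the first digon, it equals that digon and misses the second
    one. Otherwise the missing edge is put in second place. *)
Lemma cycle_avoids_digon v c d v' c' d' :
    digon (S := S) v c d -> digon (S := S) v' c' d' ->
    (forall e, e \in [:: (v, c); (v, d)] -> e \notin [:: (v', c'); (v', d')]) ->
  exists v0 c0 d0, digon (S := S) v0 c0 d0 /\ (v0, d0) \notin cycle_edges z c1 m ck.
Proof.
move=> [cd vcd] [cd' vcd'] disj.
set D := cycle_edges z c1 m ck.
have [dD|dD] := boolP ((v, d) \in D); last by exists v, c, d.
have [cD|cD] := boolP ((v, c) \in D); last by exists v, d, c; split=> //; split=> //; rewrite eq_sym.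
have [d'D|d'D] := boolP ((v', d') \in D); last by exists v', c', d'.
have par e : joins lend rend (v, e) (enum_rank ((false, v) : vtx S)) (enum_rank ((true, fw e v) : vtx S)).
  by rewrite joins_edge /= /edge_of /sstep /= !eqxx.
have cdn : (v, c) != (v, d) by rewrite xpair_eqE eqxx.
have joins_d := par d; rewrite -vcd in joins_d.
have steps0 := cycle_parallel (@ends_neq S) cycle_first (walk_steps _ _) cycle_last cycle_uniq cD dD cdn (par c) joins_d.
move: cD dD d'D; rewrite /D /cycle_edges steps0 /= => cD dD d'D.
suff /disj : (v', d') \in [:: (v, c); (v, d)] by rewrite !inE eqxx orbT.
move: cD dD d'D; rewrite !inE => /orP[]/eqP cE /orP[]/eqP dE.
- by rewrite cE dE eqxx in cdn.
- by rewrite cE dE.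
- by rewrite cE dE orbC.
- by rewrite cE dE eqxx in cdn.
Qed.
End Cycle.

Lemma signing_destroying_cycle (S : system) (x z : vtx S) c1 m ck :
    admissible x -> simple_cycle z c1 m ck ->
  exists s, admissible (over s x false) /\ path_sign s z (c1 :: rcons m ck).
Proof.
move=> [trans spec [v [c [d [v' [c' [d' [vcd vcd' disj]]]]]]]] cyc.
have [v0 [c0 [d0 [dig dD]]]] := cycle_avoids_digon cyc vcd vcd' disj.
have [c0d0 v0cd] := dig.
have cdn : (v0, c0) != (v0, d0) by rewrite xpair_eqE eqxx.
have lend_cd : left_end (S := S) (v0, c0) = left_end (v0, d0) by [].
have rend_cd : right_end (S := S) (v0, c0) = right_end (v0, d0) by rewrite /right_end /= v0cd.
have [s [s_cd s_cyc det_gt0]] := @good_signing R _ _ _ _ (@ends_neq S) (@card_incident S)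
  _ _ cdn lend_cd rend_cd _ _ _ _ _ (cycle_first z c1) (walk_steps (sstep c1 z) m)
  (cycle_last cyc) (cycle_uniq cyc) (sc_edges cyc) dD.
have s_neg : path_sign s z (c1 :: rcons m ck).
  move: s_cyc; rewrite path_sign_steps /sgn -!signr_addb /= -cats1 path_sign_cat /= addbF addbA.
  by case: (_ (+) _) => //; rewrite expr0 => /eqP; rewrite -subr_eq0 opprK -(natrD _ 1 1) pnatr_eq0.
exists s; split=> //; split.
- have lz : act (c1 :: rcons m ck) z = z.
    by rewrite -rcons_cons -cats1 cwalk_cat; exact: sc_closed cyc.
  exact: (lift_transitive trans lz s_neg).
- exact: spectrum_lift.
(* The two lifts of the preserved digon are the two disjoint digons of the next stage. *)
exists (v0, false), c0, d0, (v0, true), c0, d0.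
split; [exact: lift_digon|exact: lift_digon|].
by move=> e; rewrite !inE => /orP[]/eqP->; rewrite !xpair_eqE /= !andbF.
Qed.

Lemma stage_signing (S : system) (x : vtx S) (w : seq 'I_5) : admissible x ->
  exists s, admissible (over s x false) /\
    (reduced w -> w != [::] -> act w x = x ->
       (trail_size x w < trail_size (over s x false) w)%N).
Proof.
move=> x_adm; have [/and3P[w_red w0 /eqP wx]|not_closed] :=
    boolP [&& reduced w, w != [::] & act w x == x].
  have wU : ~~ uniq (x :: visits x w).
    case: w w0 wx {w_red} => [//|c w] _ wx; rewrite /= negb_and negbK; apply/orP; left.
    have lastE : act (c :: w) x = last (sstep c x) (visits (sstep c x) w) by rewrite last_visits.
    rewrite -{1}wx lastE; exact: mem_last.
  have [w1 [c1 [m [ck [w2 [wE cyc]]]]]] := reduced_cycle w_red wU.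
  have [s [s_adm s_neg]] := signing_destroying_cycle x_adm cyc.
  exists s; split=> // _ _ _; rewrite wE; apply: trail_size_lift_lt => //.
  by rewrite -rcons_cons -cats1 cwalk_cat; exact: sc_closed cyc.
(* There is no closed walk to open, but some cycle must still get sign -1 to keep the lift
   connected; a digon serves. *)
have [_ _ [v [c [d [_ [_ [_ [dig _ _]]]]]]]] := x_adm.
have [s [s_adm _]] := signing_destroying_cycle x_adm (digon_cycle dig).
exists s; split=> // w_red w0 wx; move: not_closed.
by rewrite w_red w0 wx eqxx.
Qed.

Definition theta : system :=
  @System unit (fun _ v => v) (fun _ v => v) (fun _ _ => erefl) (fun _ _ => erefl).

(** Applying the adjacency operator twice multiplies by 25, so only the exempt eigenvalues 5 and -5
    occur. *)
Lemma theta_admissible : admissible (S := theta) (false, tt).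
Proof.
split.
- by move=> [[] []]; [exists [:: ord0]|exists [::]].
- move=> z g [v gv] gz z5 zN5.
  have gE r : 5%:R * g (~~ r, tt) = z * g (r, tt).
    rewrite -gz (eq_bigr (fun=> g (~~ r, tt))) => [|c _]; last by case: r.
    by rewrite sumr_const card_ord mulr_natl.
  have : (z - 5%:R) * (z + 5%:R) * g v = 0.
    case: v gv => r [] _; have := gE r; have := gE (~~ r); rewrite negbK => E1 E2.
    have -> : (z - 5%:R) * (z + 5%:R) * g (r, tt) = z * (z * g (r, tt)) - 5%:R * (5%:R * g (r, tt)) by ring.
    by rewrite -E2 E1; ring.
  by move/eqP; rewrite !mulf_eq0 (negPf gv) subr_eq0 (negPf z5) addr_eq0 (negPf zN5).
exists tt, (inord 0), (inord 1), tt, (inord 2), (inord 3); split.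
- by split=> //; rewrite -val_eqE /= !inordK.
- by split=> //; rewrite -val_eqE /= !inordK.
- by move=> e; rewrite !inE => /orP[]/eqP->; rewrite !xpair_eqE -!val_eqE /= !inordK.
Qed.

Record stage := Stage {
  stage_sys : system;
  stage_pt : vtx stage_sys;
  stage_adm : admissible stage_pt }.

(* Every word is treated at infinitely many stages. *)
Definition stage_word (n : nat) : seq 'I_5 := odflt [::] (unpickle (logn 2 n)).

Definition next_sign n (t : stage) :=
  projT1 (cid (stage_signing (stage_word n) (stage_adm t))).

Lemma next_signP n (t : stage) : let s := next_sign n t in let w := stage_word n in
  admissible (over s (stage_pt t) false) /\
  (reduced w -> w != [::] -> act w (stage_pt t) = stage_pt t ->
     (trail_size (stage_pt t) w < trail_size (over s (stage_pt t) false) w)%N).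
Proof. exact: (projT2 (cid (stage_signing (stage_word n) (stage_adm t)))). Qed.

Definition next_stage n (t : stage) : stage := Stage (next_signP n t).1.

Fixpoint tower n : stage := if n is m.+1 then next_stage m (tower m) else Stage theta_admissible.

Lemma trail_size_tower_le w n k :
  (trail_size (stage_pt (tower n)) w <= trail_size (stage_pt (tower (n + k))) w)%N.
Proof.
elim: k => [|k IHk]; first by rewrite addn0.
rewrite addnS; exact: leq_trans IHk (trail_size_lift _ _ _ _).
Qed.

(** Each treatment of a nonempty closed [w] enlarges its trail, so some stage would have a trail of
    more than [(size w).+1] vertices. *)
Lemma tower_opens (w : seq 'I_5) : reduced w ->
  (forall n, act w (stage_pt (tower n)) = stage_pt (tower n)) -> w = [::].
Proof.
move=> w_red w_closed; apply/eqP; apply: contraT => w0.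
have [N] : exists N, ((size w).+2 <= trail_size (stage_pt (tower N)) w)%N.
  elim: (size w).+2 => [|k [N IHN]]; first by exists 0%N.
  (* The odd factor keeps the 2-adic valuation, hence the word, and makes [M] at least [N]. *)
  pose M := (2 ^ pickle w * N.*2.+1)%N.
  have wM : stage_word M = w.
    rewrite /stage_word lognM ?expn_gt0// lognX logn_prime// eqxx muln1.
    by rewrite logn_coprime ?addn0 ?pickleK// coprime2n /= odd_double.
  have NM : (N <= M)%N.
    by rewrite /M -[leqLHS]mul1n leq_mul ?expn_gt0// -addnn -addSn leq_addl.
  exists M.+1; apply: leq_ltn_trans IHN _.
  have := trail_size_tower_le w N (M - N); rewrite subnKC// => /leq_ltn_trans; apply.
  have [_] := next_signP M (tower M); rewrite wM; exact.
rewrite ltnNge; case/negP; rewrite /trail_size (leq_trans (size_undup _))//=.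
by rewrite size_scanl.
Qed.

Lemma ramanujan_space (S : system) : spectrum_le4 R S -> ramanujan R (cgraph (space S)) 4.
Proof.
move=> specS; split.
- by apply: finite_cgraph; exact: finite_finset.
- exact: regular_cgraph.
move=> z [g g_neq0 gz] z5 zN5.
have -> : 2 * sqrtC 4%:R = 4 :> R[i].
  by rewrite (_ : 4%:R = 2 ^+ 2) ?sqrCK// -?natrX// -natrM.
apply: (specS z g) => // x; rewrite -gz.
by rewrite (adjacency_cgraph (A := space S)).
Qed.
End Tower.

Theorem theorem1p2 (R : realType) :
  exists (q : nat) (X : nat -> graph) (f : forall n, graph_hom (X n.+1) (X n))
         (T : graph) (p : forall n, graph_hom T (X n)),
    (1 <= q)%N /\
    (forall n, connected_graph (X n)) /\
    (forall n, ramanujan R (X n) q) /\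
    (forall n, covering (f n)) /\
    (forall n, universal_covering (p n)) /\
    (forall n, hom_eq (p n) (hom_comp (f n) (p n.+1))) /\
    (exists M : nat, forall n, exists2 g : nat,
       has_girth (X n) g & (g <= M)%N) /\
    isomorphism (minimal_common_covering_map p).
Proof.
pose S n := stage_sys (tower R n); pose x n : vtx (S n) := stage_pt (tower R n).
pose s n := next_sign n (tower R n).
have adm n : admissible R (x n) := stage_adm (tower R n).
pose f n : graph_hom (cgraph (space (S n.+1))) (cgraph (space (S n))) :=
  @chom 5 (space (two_lift (s n))) (space (S n)) (@proj _ (s n)) (@proj_step _ (s n)).
exists 4%N, (fun n => cgraph (space (S n))), f, (cgraph (word_space 5)),
  (fun n => eval_hom (A := space (S n)) (x n)).
split=> //; split; [|split; [|split; [|split; [|split; [|split]]]]].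
- by move=> n; apply: (@connected_cgraph 5 (space (S n)) (x n)); exact: adm_transitive (adm n).
- by move=> n; apply: ramanujan_space; exact: adm_spectrum (adm n).
- move=> n; apply: covering_chom => y.
  by exists (over (s n) y false); rewrite proj_over.
- by move=> n; split; [exact: tree_word_space|apply: covering_eval; exact: adm_transitive (adm n)].
- move=> n; have evalE w : eval (A := space (S n)) (x n) w =
      proj (eval (A := space (S n.+1)) (x n.+1) w).
    rewrite !eval_cwalk -{1}(proj_over (s n) (x n) false).
    exact/esym/(@cwalk_morph 5 (space (two_lift (s n))) (space (S n)) _ (@proj_step _ (s n))).
  by split=> [w|[w c]] /=; rewrite ?evalE.
- exists 2%N => n; exists 2%N => //.
  have [_ _ [v [c [d [_ [_ [_ [[cd vcd] _ _]]]]]]]] := adm n.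
  apply: (@girth_digon 5 (space (S n)) (false, v) c d) => //.
  by rewrite /= /sstep /= vcd.
- apply: minimal_common_covering_word_space => w w_closed.
  (* Since [eval] reads a word from its right end, the walk that stays closed is that of the
     reversed word. *)
  apply: val_inj => /=; apply: (can_inj revK); apply: (@tower_opens R); last first.
    by move=> n; have := w_closed n; rewrite eval_cwalk.
  by rewrite reduced_rev (valP w).
Qed.
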